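(* Let $s>0$ and $d\in\mathbb{N}$. Then $$\lim_{n\to\infty}\frac{n^s\,a_n(I_d:H^{s,\#}_{\rm mix}(\mathbb{T}^d)\to L_2(\mathbb{T}^d))}{(\ln n)^{(d-1)s}}=\Big[\frac{2^d}{(d-1)!}\Big]^s .$$
   Context: $\mathbb{N}=\{1,2,3,\dots\}$. $\mathbb{T}^d$ is the $d$-torus, represented by $[0,2\pi]^d$ with opposite sides identified. $L_2(\mathbb{T}^d)$ carries the norm $\|f|L_2(\mathbb{T}^d)\|=(\int_{\mathbb{T}^d}|f(x)|^2dx)^{1/2}$, and for $f\in L_2(\mathbb{T}^d)$ the Fourier coefficients are $c_k(f)=(2\pi)^{-d/2}\int_{\mathbb{T}^d}f(x)e^{-ikx}dx$, $k\in\mathbb{Z}^d$ (so $\|f|L_2(\mathbb{T}^d)\|^2=\sum_k|c_k(f)|^2$). For $s>0$, $H^{s,\#}_{\rm mix}(\mathbb{T}^d)$ is the space of all $f\in L_2(\mathbb{T}^d)$ for which the norm $$\|f|H^s_{\rm mix}(\mathbb{T}^d)\|^{\#}=\Big[\sum_{k\in\mathbb{Z}^d}|c_k(f)|^2\prod_{j=1}^d(1+|k_j|)^{2s}\Big]^{1/2}$$ is finite, equipped with this norm. $I_d$ denotes the identical embedding $f\mapsto f$. The approximation numbers of a bounded linear operator $T:X\to Y$ between Banach spaces are $a_n(T:X\to Y)=\inf\{\|T-A:X\to Y\| : A:X\to Y \text{ bounded linear},\ {\rm rank}\,A<n\}$, $n\in\mathbb{N}$. *)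

(* Defs.v *)
From HB Require Import structures.
From mathcomp Require Import all_boot all_order all_algebra.
From mathcomp Require Import all_classical all_reals all_analysis.
From mathcomp Require Import measurable_realfun.
From mathcomp Require Import complex lra.

Set Implicit Arguments.
Unset Strict Implicit.
Unset Printing Implicit Defensive.
Import Order.TTheory GRing.Theory Num.Theory.
Import numFieldNormedType.Exports.

Local Open Scope classical_set_scope.
Local Open Scope ring_scope.
Local Open Scope complex_scope.

Local Notation normc := Normc.normc.

Section torus_measure.
Context {R : realType}.

Definition circle_measure : set (measurableTypeR R) -> \bar R :=
  mrestr (@lebesgue_measure R) (measurable_itv `[0, 2 * pi]).

HB.instance Definition _ := Measure.on circle_measure.

Let circle_measure_fin : fin_num_fun circle_measure.
Proof.
apply: lty_fin_num_fun; rewrite [X in (X < _)%E]/= /circle_measure /mrestr setTI.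
by rewrite lebesgue_measure_itv/=; case: ifP => _; rewrite ?ltry.
Qed.

HB.instance Definition _ := @Measure_isFinite.Build _ _ _ circle_measure
  circle_measure_fin.

(* Points are taken in R^d with the product Borel sigma-algebra. Only the cube
   [0, 2 pi]^d is charged by torus_measure below, so a function modulo a.e.
   equality is a function on the torus (opposite sides are null sets). *)
Definition torus (d : nat) := d.-tuple (measurableTypeR R).

Definition torus_cons n (x : measurableTypeR R * n.-tuple (measurableTypeR R)) :
  n.+1.-tuple (measurableTypeR R) := [the n.+1.-tuple _ of x.1 :: x.2].

Lemma measurable_torus_cons n : measurable_fun setT (@torus_cons n).
Proof. exact: measurable_cons. Qed.

HB.instance Definition _ n :=
  @isMeasurableFun.Build _ _ _ _ (@torus_cons n) (@measurable_torus_cons n).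

Section step.
Context {n : nat}.
Variable m : {finite_measure set n.-tuple (measurableTypeR R) -> \bar R}.

Definition torus_measure_step : set (n.+1.-tuple (measurableTypeR R)) -> \bar R :=
  pushforward (circle_measure \x m)%E (@torus_cons n).

Let step0 : torus_measure_step set0 = 0%E.
Proof. exact: measure0. Qed.

Let step_ge0 A : (0 <= torus_measure_step A)%E.
Proof. exact: measure_ge0. Qed.

Let step_sigma_additive : semi_sigma_additive torus_measure_step.
Proof. exact: measure_semi_sigma_additive. Qed.

HB.instance Definition _ := isMeasure.Build _ _ _ torus_measure_step
  step0 step_ge0 step_sigma_additive.

Let step_fin : fin_num_fun torus_measure_step.
Proof.
apply: lty_fin_num_fun.
rewrite [X in (X < _)%E]/= /torus_measure_step /pushforward preimage_setT.
by rewrite -setXTT product_measure1E// ltey_eq fin_numM ?fin_num_measure.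
Qed.

HB.instance Definition _ := @Measure_isFinite.Build _ _ _ torus_measure_step
  step_fin.

End step.

Fixpoint torus_measure (d : nat) :
    {finite_measure set d.-tuple (measurableTypeR R) -> \bar R} :=
  match d with
  | 0 => [the {finite_measure set _ -> \bar R} of
           @dirac _ (0.-tuple (measurableTypeR R)) [tuple] R]
  | n.+1 => [the {finite_measure set _ -> \bar R} of
              torus_measure_step (torus_measure n)]
  end.

End torus_measure.
Arguments torus : clear implicits.

Section complex_integral.
Context {R : realType} {d : measure_display} {T : measurableType d}.
Variable mu : {measure set T -> \bar R}.

Definition cmeasurable (f : T -> R[i]) : Prop :=
  measurable_fun setT (fun x => complex.Re (f x)) /\
  measurable_fun setT (fun x => complex.Im (f x)).

Definition cintegral (f : T -> R[i]) : R[i] :=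
  (\int[mu]_x complex.Re (f x)) +i* (\int[mu]_x complex.Im (f x)).

End complex_integral.

Section approximation_numbers.
Context {R : realType} {X Y : lmodType R[i]}.

(* The range of A has a basis A e_0, ..., A e_(m-1). *)
Definition has_rank (A : {linear X -> Y}) (m : nat) : Prop :=
  exists e : 'I_m -> X,
    (forall c : 'I_m -> R[i],
       \sum_i c i *: A (e i) = 0 -> forall i, c i = 0) /\
    (forall x, exists c : 'I_m -> R[i], A x = \sum_i c i *: A (e i)).

(* The norms are explicit functions because Hmix below, a subspace of L2,
   carries a norm different from the one it would inherit. *)
Variables (normX : X -> R) (normY : Y -> R).

Definition bounded_op (A : X -> Y) : Prop :=
  exists M : R, forall x, normY (A x) <= M * normX x.

Definition op_norm (A : X -> Y) : R :=
  sup [set normY (A x) | x in [set x | normX x <= 1]].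

Definition approx_number (T : {linear X -> Y}) (n : nat) : R :=
  inf [set a | exists A : {linear X -> Y},
    [/\ bounded_op A, exists2 m, (m < n)%N & has_rank A m &
        a = op_norm (fun x => T x - A x)]].

End approximation_numbers.

Section complex_numbers.
Context {R : realType}.
Implicit Types x y : R[i].

Lemma sqr_normcE x : normc x ^+ 2 = complex.Re x ^+ 2 + complex.Im x ^+ 2.
Proof. by case: x => a b /=; rewrite sqr_sqrtr// addr_ge0 ?sqr_ge0. Qed.

Lemma complexReM x y : complex.Re (x * y) =
  complex.Re x * complex.Re y - complex.Im x * complex.Im y.
Proof. by case: x => a b; case: y. Qed.

Lemma complexImM x y : complex.Im (x * y) =
  complex.Re x * complex.Im y + complex.Im x * complex.Re y.
Proof. by case: x => a b; case: y. Qed.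

Lemma sqr_normcD x y : normc (x + y) ^+ 2 <= 2 * normc x ^+ 2 + 2 * normc y ^+ 2.
Proof.
rewrite !sqr_normcE; case: x => a b; case: y => c e /=.
have := sqr_ge0 (a - c); have := sqr_ge0 (b - e); nra.
Qed.

End complex_numbers.

Section L2.
Context {R : realType} (d : nat).
Local Notation mu := (@torus_measure R d).

Definition sq_integrable : {pred torus R d -> R[i]} :=
  mem [set f | cmeasurable f /\
               (\int[mu]_x (normc (f x) ^+ 2)%:E < +oo)%E].

Lemma cmeasurable_normc (f : torus R d -> R[i]) : cmeasurable f ->
  measurable_fun setT (fun x => normc (f x) ^+ 2).
Proof.
move=> [mr mi]; under eq_fun do rewrite sqr_normcE.
by apply: measurable_funD; apply: measurable_funX.
Qed.

Lemma cmeasurableZD (a : R[i]) (f g : torus R d -> R[i]) :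
  cmeasurable f -> cmeasurable g -> cmeasurable (a *: f + g).
Proof.
move=> [fr fi] [gr gi]; split.
  rewrite (_ : (fun _ => _) = fun x => complex.Re a * complex.Re (f x) -
      complex.Im a * complex.Im (f x) + complex.Re (g x)).
    apply: measurable_funD => //; apply: measurable_funB;
    by apply: measurable_funM => //; exact: measurable_cst.
  apply/funext => x; rewrite -[(_ + _) x]/(a * f x + g x).
  by case: a (f x) (g x) => a b [? ?] [? ?].
rewrite (_ : (fun _ => _) = fun x => complex.Re a * complex.Im (f x) +
    complex.Im a * complex.Re (f x) + complex.Im (g x)).
  apply: measurable_funD => //; apply: measurable_funD;
  by apply: measurable_funM => //; exact: measurable_cst.
apply/funext => x; rewrite -[(_ + _) x]/(a * f x + g x).
by case: a (f x) (g x) => a b [? ?] [? ?].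
Qed.

Lemma sq_integrable_submod : GRing.submod_closed sq_integrable.
Proof.
split.
  rewrite inE; split; first by split; exact: measurable_cst.
  under eq_integral do rewrite Normc.normc0 expr0n.
  by rewrite integral0.
move=> a f g; rewrite !inE => -[mf If] [mg Ig].
split; first exact: cmeasurableZD.
have mn (h : torus R d -> R[i]) :
  cmeasurable h -> measurable_fun setT (fun x => (normc (h x) ^+ 2)%:E).
  by move=> mh; apply/measurable_EFinP; exact: cmeasurable_normc.
apply: (@le_lt_trans _ _ (\int[mu]_x ((2 * normc a ^+ 2)%:E *
    (normc (f x) ^+ 2)%:E + 2%:E * (normc (g x) ^+ 2)%:E))%E).
  apply: ge0_le_integral => //.
  - by move=> x _; rewrite lee_fin sqr_ge0.
  - by apply: mn; exact: cmeasurableZD.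
  - by apply: emeasurable_funD; apply: measurable_funeM; exact: mn.
  - move=> x _; rewrite -!EFinM -EFinD lee_fin.
    by apply: (le_trans (sqr_normcD _ _)); rewrite /= Normc.normcM exprMn mulrA.
rewrite ge0_integralD//=; last 4 first.
- by move=> x _; rewrite -EFinM lee_fin mulr_ge0 ?sqr_ge0// mulr_ge0 ?sqr_ge0.
- by apply: measurable_funeM; exact: mn.
- by move=> x _; rewrite -EFinM lee_fin mulr_ge0 ?sqr_ge0// mulr_ge0 ?sqr_ge0.
- by apply: measurable_funeM; exact: mn.
rewrite !ge0_integralZl//=.
- apply: lte_add_pinfty; apply: lte_mul_pinfty => //.
  by rewrite lee_fin mulr_ge0 ?sqr_ge0.
- exact: mn.
- by move=> x _; rewrite lee_fin sqr_ge0.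
- exact: mn.
- by move=> x _; rewrite lee_fin sqr_ge0.
- by rewrite lee_fin mulr_ge0 ?sqr_ge0.
Qed.

HB.instance Definition _ := GRing.isSubmodClosed.Build R[i]
  (torus R d -> R[i]) sq_integrable sq_integrable_submod.

Definition L2fun := {f : torus R d -> R[i] | f \in sq_integrable}.

HB.instance Definition _ := SubChoice.on L2fun.
HB.instance Definition _ := [SubChoice_isSubLmodule of L2fun by <:].

Definition L2_null : {pred L2fun} :=
  mem [set f | \forall x \ae mu, val f x = 0].

Lemma L2_null_submod : GRing.submod_closed L2_null.
Proof.
split; first by rewrite inE; apply: filterE => x; rewrite raddf0.
move=> a f g; rewrite !inE; apply: filterS2 => x fx gx.
rewrite linearP -[(_ + _) x]/(a * val f x + val g x).
by rewrite fx gx mulr0 addr0.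
Qed.

HB.instance Definition _ := GRing.isZmodClosed.Build L2fun L2_null
  (GRing.submod_closedB L2_null_submod).

(* The elements of L2 are a.e. classes; L2_norm and coef below are computed on a
   representative. *)
Definition L2 := Quotient.quot L2_null.

HB.instance Definition _ := Choice.on L2.
HB.instance Definition _ := EqQuotient.on L2.
HB.instance Definition _ := GRing.Zmodule.on L2.

Local Open Scope quotient_scope.

Definition L2_scale (a : R[i]) (x : L2) : L2 := \pi_L2 (a *: repr x).

Lemma L2_scale_pi (a : R[i]) (f : L2fun) :
  L2_scale a (\pi_L2 f) = \pi_L2 (a *: f).
Proof.
apply/eqP; rewrite -[_ == _]Quotient.idealrBE -scalerBr -[_ *: _]addr0.
apply: L2_null_submod.2; last exact: L2_null_submod.1.
by rewrite Quotient.idealrBE reprK.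
Qed.

Lemma L2_piD (f g : L2fun) : \pi_L2 (f + g) = \pi_L2 f + \pi_L2 g.
Proof. exact: Quotient.pi_add. Qed.

Let L2_scaleA a b x : L2_scale a (L2_scale b x) = L2_scale (a * b) x.
Proof. by rewrite -[x]reprK [L2_scale b _]L2_scale_pi !L2_scale_pi scalerA. Qed.

Let L2_scale1 : left_id 1 L2_scale.
Proof. by move=> x; rewrite -[x]reprK L2_scale_pi scale1r. Qed.

Let L2_scaleDr : right_distributive L2_scale +%R.
Proof.
move=> a x y; rewrite -[x]reprK -[y]reprK -L2_piD !L2_scale_pi -L2_piD.
by rewrite scalerDr.
Qed.

Let L2_scaleDl x : {morph L2_scale^~ x : a b / a + b}.
Proof. by move=> a b; rewrite -[x]reprK !L2_scale_pi -L2_piD scalerDl. Qed.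

HB.instance Definition _ := GRing.Zmodule_isLmodule.Build R[i] L2
  L2_scaleA L2_scale1 L2_scaleDr L2_scaleDl.

Definition L2_norm (x : L2) : R :=
  Num.sqrt (\int[mu]_t normc (val (repr x) t) ^+ 2).

End L2.
Arguments L2fun : clear implicits.
Arguments L2 : clear implicits.

Section fourier.
Local Open Scope quotient_scope.
Context {R : realType} {d : nat}.
Local Notation mu := (@torus_measure R d).

(* exp(i t) *)
Definition expi (t : R) : R[i] := cos t +i* sin t.

Definition phase (k : d.-tuple int) (x : torus R d) : R :=
  \sum_(j < d) (tnth k j)%:~R * tnth x j.

(* (2 pi)^(-d/2) times the integral of f(x) exp(-i k.x) over the torus *)
Definition fun_coef (f : torus R d -> R[i]) (k : d.-tuple int) : R[i] :=
  ((2 * pi) `^ (- (d%:R / 2)))%:C *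
  cintegral mu (fun x => f x * expi (- phase k x)).

Definition coef (f : L2 R d) (k : d.-tuple int) : R[i] :=
  fun_coef (val (repr f)) k.

Lemma measurable_phase k : measurable_fun setT (fun x => - phase k x).
Proof.
apply: measurable_funN; apply: measurable_sum => j.
by apply: measurable_funM; [exact: measurable_cst|exact: measurable_tnth].
Qed.

Lemma normc_expi t : normc (expi t) ^+ 2 = 1.
Proof. by rewrite sqr_normcE /= cos2Dsin2. Qed.

Lemma integrable_modulated (f : torus R d -> R[i]) k : f \in @sq_integrable R d ->
  mu.-integrable setT (fun x => (complex.Re (f x * expi (- phase k x)))%:E) /\
  mu.-integrable setT (fun x => (complex.Im (f x * expi (- phase k x)))%:E).
Proof.
rewrite inE => -[[mr mi] If].
have mc : measurable_fun setT (fun x : torus R d => cos (- phase k x)).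
  apply: measurableT_comp (measurable_phase k).
  by apply: continuous_measurable_fun; exact: continuous_cos.
have ms : measurable_fun setT (fun x : torus R d => sin (- phase k x)).
  apply: measurableT_comp (measurable_phase k).
  by apply: continuous_measurable_fun; exact: continuous_sin.
pose g (x : torus R d) : \bar R := ((cst 1%:E \+ (fun x => (normc (f x) ^+ 2)%:E)) x)%E.
have ig : mu.-integrable setT g.
  apply: integrableD => //; first exact: finite_measure_integrable_cst.
  apply/integrableP; split.
    by apply/measurable_EFinP; exact: cmeasurable_normc.
  by under eq_integral do rewrite gee0_abs ?lee_fin ?sqr_ge0//.
have bound (z w : R[i]) : normc w ^+ 2 = 1 ->
    `|complex.Re (z * w)| <= 1 + normc z ^+ 2 /\
    `|complex.Im (z * w)| <= 1 + normc z ^+ 2.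
  move=> w1; have : normc (z * w) ^+ 2 = normc z ^+ 2.
    by rewrite Normc.normcM exprMn w1 mulr1.
  rewrite sqr_normcE; move: (complex.Re _) (complex.Im _) => a b <-.
  by split; rewrite ler_norml; apply/andP; split; nra.
have mod_ge0 x : (0 <= 1 + normc (f x) ^+ 2) by rewrite addr_ge0 ?sqr_ge0.
split; apply: (le_integrable _ _ _ ig) => //.
- apply/measurable_EFinP; under eq_fun do rewrite complexReM/=.
  by apply: measurable_funB; apply: measurable_funM.
- move=> x _; rewrite /g /= lee_fin (ger0_norm (mod_ge0 x)).
  by have [] := bound (f x) _ (normc_expi (- phase k x)).
- apply/measurable_EFinP; under eq_fun do rewrite complexImM/=.
  by apply: measurable_funD; apply: measurable_funM.
- move=> x _; rewrite /g /= lee_fin (ger0_norm (mod_ge0 x)).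
  by have [] := bound (f x) _ (normc_expi (- phase k x)).
Qed.

Lemma fun_coef_linear (a : R[i]) (f g : torus R d -> R[i]) k :
  f \in @sq_integrable R d -> g \in @sq_integrable R d ->
  fun_coef (a *: f + g) k = a * fun_coef f k + fun_coef g k.
Proof.
move=> /(integrable_modulated k)[fr fi] /(integrable_modulated k)[gr gi].
rewrite /fun_coef mulrCA -mulrDr; congr (_ * _).
rewrite /cintegral.
have iZ (c : R) (h : torus R d -> R) :
    mu.-integrable setT (fun x => (h x)%:E) ->
    mu.-integrable setT (fun x => (c * h x)%:E).
  by move=> ih; under eq_fun do rewrite EFinM; exact: integrableZl.
have iD (h1 h2 : torus R d -> R) :
    mu.-integrable setT (fun x => (h1 x)%:E) ->
    mu.-integrable setT (fun x => (h2 x)%:E) ->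
    mu.-integrable setT (fun x => (h1 x + h2 x)%:E).
  by move=> ih1 ih2; under eq_fun do rewrite EFinD; exact: integrableD.
have iB (h1 h2 : torus R d -> R) :
    mu.-integrable setT (fun x => (h1 x)%:E) ->
    mu.-integrable setT (fun x => (h2 x)%:E) ->
    mu.-integrable setT (fun x => (h1 x - h2 x)%:E).
  by move=> ih1 ih2; under eq_fun do rewrite EFinB; exact: integrableB.
have -> : (\int[mu]_x complex.Re ((a *: f + g) x * expi (- phase k x))) =
  complex.Re a * (\int[mu]_x complex.Re (f x * expi (- phase k x))) -
  complex.Im a * (\int[mu]_x complex.Im (f x * expi (- phase k x))) +
  \int[mu]_x complex.Re (g x * expi (- phase k x)).
  rewrite -!RintegralZl// -RintegralB//; last 2 first.
  - exact: iZ.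
  - exact: iZ.
  rewrite -RintegralD//; last first.
    by apply: iB; exact: iZ.
  apply: eq_Rintegral => x _; rewrite -[(_ + _) x]/(a * f x + g x).
  by rewrite mulrDl -mulrA; move: (f x * _) (g x * _) a => [? ?] [? ?] [? ?].
have -> : (\int[mu]_x complex.Im ((a *: f + g) x * expi (- phase k x))) =
  complex.Re a * (\int[mu]_x complex.Im (f x * expi (- phase k x))) +
  complex.Im a * (\int[mu]_x complex.Re (f x * expi (- phase k x))) +
  \int[mu]_x complex.Im (g x * expi (- phase k x)).
  rewrite -!RintegralZl// -RintegralD//; last 2 first.
  - exact: iZ.
  - exact: iZ.
  rewrite -RintegralD//; last first.
    by apply: iD; exact: iZ.
  apply: eq_Rintegral => x _; rewrite -[(_ + _) x]/(a * f x + g x).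
  by rewrite mulrDl -mulrA; move: (f x * _) (g x * _) a => [? ?] [? ?] [? ?].
by case: a.
Qed.

Lemma coef_pi (f : L2fun R d) k : coef (\pi_(L2 R d) f) k = fun_coef (val f) k.
Proof.
rewrite /coef; set g := repr _.
have : f == g %[mod L2 R d] by rewrite reprK.
rewrite -[_ == _]Quotient.idealrBE inE => fg0.
have fg : \forall x \ae mu, val g x = val f x.
  by apply: filterS fg0 => x; rewrite raddfB => /subr0_eq.
have [gr gi] := integrable_modulated k (valP g).
have [fr fi] := integrable_modulated k (valP f).
rewrite /fun_coef /cintegral; congr (_ * (_ +i* _)); congr fine.
- apply: ae_eq_integral => //; [exact: measurable_int gr|exact: measurable_int fr|].
  by apply: filterS fg => x -> _.
- apply: ae_eq_integral => //; [exact: measurable_int gi|exact: measurable_int fi|].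
  by apply: filterS fg => x -> _.
Qed.

Lemma coef_linear (a : R[i]) (f g : L2 R d) k :
  coef (a *: f + g) k = a * coef f k + coef g k.
Proof.
have -> : a *: f + g = \pi_(L2 R d) (a *: repr f + repr g).
  by rewrite L2_piD reprK.
by rewrite coef_pi linearP fun_coef_linear//; exact: valP.
Qed.

Lemma coef0 k : coef (0 : L2 R d) k = 0.
Proof. by have := coef_linear (-1) 0 0 k; rewrite scaler0 addr0 mulN1r addNr. Qed.

End fourier.

Section mixed_sobolev.
Context {R : realType} {d : nat}.
Variable s : R.

Definition mixed_weight (k : d.-tuple int) : R :=
  \prod_(j < d) (1 + `|tnth k j|%:~R) `^ (2 * s).

Definition mixed_sqnorm (f : L2 R d) : \bar R :=
  \esum_(k in [set: d.-tuple int]) (normc (coef f k) ^+ 2 * mixed_weight k)%:E.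

Definition in_Hmix : {pred L2 R d} := mem [set f | (mixed_sqnorm f < +oo)%E].

Lemma mixed_weight_ge0 k : 0 <= mixed_weight k.
Proof. by apply: prodr_ge0 => j _; exact: powR_ge0. Qed.

Lemma in_HmixP f : f \in in_Hmix <-> (mixed_sqnorm f < +oo)%E.
Proof. by rewrite inE. Qed.

Lemma in_Hmix_submod : GRing.submod_closed in_Hmix.
Proof.
have le_esumZ (T : choiceType) (c : R) (a : T -> \bar R) : 0 <= c ->
    (forall i, 0 <= a i)%E ->
    (\esum_(i in [set: T]) (c%:E * a i) <= c%:E * \esum_(i in [set: T]) a i)%E.
  move=> c0 a0; apply: ge_ereal_sup => _ [F [finF FT] <-].
  rewrite -ge0_mule_fsumr//; apply: lee_wpmul2l; first by rewrite lee_fin.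
  by apply: esum_ge; exists F.
split.
  apply/in_HmixP; rewrite /mixed_sqnorm esum1// => k _.
  by rewrite coef0 Normc.normc0 expr0n mul0r.
move=> a f g /in_HmixP If /in_HmixP Ig; apply/in_HmixP.
have ge0 h k : (0 <= (normc (coef h k) ^+ 2 * mixed_weight k)%:E)%E.
  by rewrite lee_fin mulr_ge0 ?sqr_ge0 ?mixed_weight_ge0.
have ca : 0 <= 2 * normc a ^+ 2 by rewrite mulr_ge0 ?sqr_ge0.
apply: (@le_lt_trans _ _ (\esum_(k in [set: d.-tuple int])
   ((2 * normc a ^+ 2)%:E * (normc (coef f k) ^+ 2 * mixed_weight k)%:E +
    2%:E * (normc (coef g k) ^+ 2 * mixed_weight k)%:E))%E).
  apply: le_esum => k _; rewrite -!EFinM -EFinD lee_fin coef_linear.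
  have := ler_wpM2r (mixed_weight_ge0 k) (sqr_normcD (a * coef f k) (coef g k)).
  by rewrite Normc.normcM exprMn; lra.
rewrite esumD; last 2 first.
- by move=> k _; apply: mule_ge0; rewrite ?ge0.
- by move=> k _; apply: mule_ge0; rewrite ?ge0.
apply: lte_add_pinfty.
  apply: (le_lt_trans (le_esumZ _ _ _ ca (ge0 f))).
  by apply: lte_mul_pinfty If; rewrite ?lee_fin.
apply: (le_lt_trans (le_esumZ _ 2 _ (ler0n _ 2) (ge0 g))).
by apply: lte_mul_pinfty Ig; rewrite ?lee_fin.
Qed.

HB.instance Definition _ := GRing.isSubmodClosed.Build R[i] (L2 R d) in_Hmix
  in_Hmix_submod.

Definition Hmix := {f : L2 R d | f \in in_Hmix}.

HB.instance Definition _ := SubChoice.on Hmix.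
HB.instance Definition _ := [SubChoice_isSubLmodule of Hmix by <:].

Definition Hmix_norm (f : Hmix) : R := Num.sqrt (fine (mixed_sqnorm (val f))).

Definition Hmix_embedding : {linear Hmix -> L2 R d} :=
  [the {linear Hmix -> L2 R d} of val].

End mixed_sobolev.
Arguments Hmix {R} d s.
Arguments Hmix_embedding {R} d s.

(* Main.v *)
Require Import Defs.
From HB Require Import structures.
From mathcomp Require Import all_boot all_order all_algebra.
From mathcomp Require Import all_classical all_reals all_analysis.
From mathcomp Require Import measurable_realfun.
From mathcomp Require Import complex ring lra zify.

Set Implicit Arguments.
Unset Strict Implicit.
Unset Printing Implicit Defensive.
Import Order.TTheory GRing.Theory Num.Theory.
Import numFieldNormedType.Exports.

Local Open Scope classical_set_scope.
Local Open Scope ring_scope.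

(* The embedding is diagonal in the Fourier basis, so its approximation numbers
   are the decreasingly ordered inverse weights: if C(N) is the number of k in Z^d
   with (1 + |k_1|) ... (1 + |k_d|) <= N and C(m - 1) < n <= C(m), then
   a_n = m^(-s). The upper bound uses the partial Fourier sum and Parseval, the
   lower bound a kernel vector in the span of C(m) >= n characters.

   C_(d+1)(N) = C_d(N) + 2 (C_d(N/2) + C_d(N/3) + ...), and comparing such sums
   with an integral gives C_d(N) ~ 2^d N (ln N)^(d-1) / (d-1)!, which is inverted.

   Parseval rests on the density of trigonometric polynomials. The sets whose
   indicator function is an L2 limit of trigonometric polynomials form a
   sigma-algebra. It contains the half-spaces {x_j < a}: there is a trigonometric
   polynomial p with values in [0, 1] such that p < 1/2 iff x_j < a, and
   (1 - p^n)^(2^n) tends to the indicator function of {p < 1/2}. *)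

(** * Counting the hyperbolic cross *)

Section hyperbolic_cross.

(** The weights are powers of integers, so no asymptotics enter on the operator side: the limit is
    purely a statement about the counting function. Its recursion divides by |k| + 1 and leaves the
    integers, so both counting bounds carry a real argument beside the integer one. They lose only a
    shift inside the logarithm (and a factor 1 - e from below), which disappears in the limit. In
    the inversion ln m may replace ln n because C(m) lies between m and a constant times m (ln m +
    O(1))^(d-1).

    Completeness of the characters is the deep analytic input: without it coefficients would not
    control the norm, and the remainder of a partial sum could not be estimated. Orthogonality is
    packed into one identity for the squared norm of x - a e_k. The polynomial p comes from the
    circle, where 0 < x_j < a is an arc: a cosine centred at the middle of the arc exceeds its end
    value exactly there. *)

Definition int_ball (N : nat) : seq int :=
  [seq Posz i | i <- iota 0 N] ++ [seq Negz i | i <- iota 0 N.-1].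

Lemma mem_int_ball N k : (k \in int_ball N) = (`|k| < N)%N.
Proof.
rewrite mem_cat; case: k => k.
  rewrite mem_map; last by move=> ? ? [].
  rewrite mem_iota /= add0n; case: (k < N)%N => //=.
  by apply/mapP => -[].
rewrite mem_map; last by move=> ? ? [].
rewrite mem_iota/= add0n.
have -> : (Negz k \in [seq Posz i | i <- iota 0 N]) = false.
  by apply/mapP => -[].
by case: N.
Qed.

Lemma int_ball_uniq N : uniq (int_ball N).
Proof.
rewrite cat_uniq !map_inj_uniq ?iota_uniq; try by move=> ? ? [].
rewrite andbT /=; apply/hasPn => _ /mapP[i _ ->].
by apply/mapP => -[].
Qed.

(** Recursion on the first frequency k: the other factors have an integer product, so rounding N /
    (|k| + 1) down loses nothing. In dimension 0 the empty product is 1, whence the single point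
    belongs to the cross only for N > 0. *)
Fixpoint hcross (d : nat) : nat -> seq (d.-tuple int) :=
  match d with
  | 0 => fun N => nseq (0 < N)%N [tuple]
  | d'.+1 => fun N =>
      [seq [tuple of k :: (t : d'.-tuple int)] |
        k <- int_ball N, t <- hcross d' (N %/ `|k|.+1)]
  end.

Definition freq_size d (k : d.-tuple int) : nat := \prod_(j < d) `|tnth k j|.+1.

Lemma freq_size_gt0 d (k : d.-tuple int) : (0 < freq_size k)%N.
Proof. exact: prodn_gt0. Qed.

Lemma freq_size_cons d z (k : d.-tuple int) :
  freq_size [tuple of z :: k] = (`|z|.+1 * freq_size k)%N.
Proof.
rewrite /freq_size big_ord_recl tnth0; congr (_ * _)%N.
by apply: eq_bigr => i _; rewrite tnthS.
Qed.

Lemma mem_hcross d N (k : d.-tuple int) : (k \in hcross d N) = (freq_size k <= N)%N.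
Proof.
elim: d N k => [|d IH] N k.
  by rewrite /freq_size big_ord0 tuple0 /=; case: N => //= N; rewrite inE eqxx.
case/tupleP: k => z k; rewrite freq_size_cons /=.
apply/allpairsPdep/idP => [[z' [k' [_ + /(congr1 val) [-> /val_inj ->]]]]|le_N].
  by rewrite IH leq_divRL// mulnC.
exists z, k; split=> //; last by rewrite IH leq_divRL// mulnC.
by rewrite mem_int_ball (leq_trans _ le_N)// leq_pmulr// freq_size_gt0.
Qed.

Lemma hcross_uniq d N : uniq (hcross d N).
Proof.
elim: d N => [|d IH] N; first by case: N.
apply: allpairs_uniq_dep; [exact: int_ball_uniq|by []|].
by move=> [z k] [z' k'] _ _ /= /(congr1 val) [-> /val_inj ->].
Qed.

Lemma size_hcross0 N : size (hcross 0 N) = (0 < N)%N.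
Proof. by rewrite size_nseq. Qed.

(** The first sum collects the frequencies k >= 0, the second those with k < 0. As [Negz i] is -(i +
    1), its factor |k| + 1 is i + 2, and zero is counted once. *)
Lemma size_hcrossS d N : size (hcross d.+1 N) =
  (\sum_(i < N) size (hcross d (N %/ i.+1)) +
   \sum_(i < N.-1) size (hcross d (N %/ i.+2)))%N.
Proof.
rewrite [hcross _ _]/= size_allpairs_dep sumnE big_map big_cat !big_map/=.
rewrite -(big_mkord predT (fun i => size (hcross d (N %/ i.+1)))).
rewrite -(big_mkord predT (fun i => size (hcross d (N %/ i.+2)))).
by rewrite /index_iota !subn0.
Qed.

Lemma hcross_nil d : hcross d 0 = [::].
Proof. by case: d. Qed.

Lemma size_hcross1 N : size (hcross 1 N) = (N + N.-1)%N.
Proof.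
rewrite size_hcrossS; congr addn; rewrite -[RHS]card_ord -sum1_card;
  apply: eq_bigr => i _; rewrite size_hcross0 divn_gt0// ?ltn_ord//.
by have := ltn_ord i; lia.
Qed.

(** Crude, but it serves twice: every n is reached, so the counting function can be inverted, and
    the inverse is at most n. *)
Lemma size_hcross_ge d N : (N <= size (hcross d.+1 N))%N.
Proof.
elim: d N => [|d IH] N; first by rewrite size_hcross1 leq_addr.
rewrite size_hcrossS; case: N => // N.
by rewrite big_ord_recl divn1 -addnA (leq_trans (IH _))// leq_addr.
Qed.

End hyperbolic_cross.

(** * Two-sided bounds for the number of points of the hyperbolic cross *)

Section counting_bounds.
Context {R : realType}.
Implicit Types (x r u v : R) (d N : nat).

(** A mean value estimate for t^(d+1): the difference quotient is a sum of d + 1 products u^(d-i)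
    v^i, each between v^d and u^d. The upper half is [subrX_le]. *)
Lemma subrX_ge d u v : 0 <= v -> v <= u ->
  d.+1%:R * v ^+ d * (u - v) <= u ^+ d.+1 - v ^+ d.+1.
Proof.
move=> v0 vu; rewrite subrXX mulrC ler_wpM2l ?subr_ge0//.
rewrite mulr_natl -[X in _ *+ X]card_ord -sumr_const ler_sum// => i _.
rewrite /= -[X in v ^+ X](@subnK i d) -1?ltnS//.
rewrite exprD ler_wpM2r ?exprn_ge0//.
by rewrite lerXn2r ?nnegrE// (le_trans v0).
Qed.

Lemma subrX_le d u v : 0 <= v -> v <= u ->
  u ^+ d.+1 - v ^+ d.+1 <= d.+1%:R * u ^+ d * (u - v).
Proof.
move=> v0 vu; have u0 := le_trans v0 vu.
rewrite subrXX mulrC ler_wpM2r ?subr_ge0//.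
rewrite mulr_natl -[X in _ *+ X]card_ord -sumr_const ler_sum// => i _.
rewrite /= -[X in u ^+ X](@subnK i d) -1?ltnS//.
by rewrite exprD ler_wpM2l ?exprn_ge0// lerXn2r ?nnegrE.
Qed.

Lemma lnS_sub_le n : ln n.+2%:R - ln n.+1%:R <= n.+1%:R^-1 :> R.
Proof.
rewrite -ln_div ?posrE//.
have -> : n.+2%:R / n.+1%:R = 1 + n.+1%:R^-1 :> R.
  by rewrite -[in X in X / _]natr1 mulrDl divff ?pnatr_eq0// mul1r addrC.
by apply: le_ln1Dx; rewrite (lt_trans _ (_ : 0 < _)) ?invr_gt0// ltrN10.
Qed.

Lemma lnS_sub_ge n : n.+2%:R^-1 <= ln n.+2%:R - ln n.+1%:R :> R.
Proof.
rewrite -lerN2 opprB -ln_div ?posrE//.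
have -> : n.+1%:R / n.+2%:R = 1 + - n.+2%:R^-1 :> R.
  have : 0 < n.+1%:R :> R by [].
  by rewrite -[n.+2%:R]natr1; move: (n.+1%:R) => y y0; field; lra.
by apply: le_ln1Dx; rewrite ltrN2 invf_lt1// ltr1n.
Qed.

(* The sum is compared with the integral of (c - ln t)^d / t, telescopically. *)
Lemma sum_pow_ln_le d N (c : R) : (forall i, (i <= N)%N -> 0 <= c - ln i.+1%:R) ->
  \sum_(i < N.+1) (c - ln i.+1%:R) ^+ d / i.+1%:R <=
  c ^+ d + (c ^+ d.+1 - (c - ln N.+1%:R) ^+ d.+1) / d.+1%:R.
Proof.
(* The term i = 0 is exactly c^d; it has no preceding increment of ln to be compared with. *)
elim: N => [|N IH] cN; first by rewrite big_ord1 ln1 subr0 subrr mul0r addr0 divr1.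
rewrite big_ord_recr /=.
have /IH {}IH : forall i, (i <= N)%N -> 0 <= c - ln i.+1%:R.
  by move=> i iN; apply: cN; rewrite ltnW.
apply: le_trans (lerD IH (lexx _)) _; rewrite -addrA lerD2l.
rewrite -[X in _ + X](mulrK (_ : d.+1%:R \is a GRing.unit)) ?unitfE ?pnatr_eq0//.
rewrite -mulrDl ler_pM2r ?invr_gt0// -lerBrDl.
have -> : c ^+ d.+1 - (c - ln N.+2%:R) ^+ d.+1 - (c ^+ d.+1 - (c - ln N.+1%:R) ^+ d.+1)
  = (c - ln N.+1%:R) ^+ d.+1 - (c - ln N.+2%:R) ^+ d.+1 by ring.
(* 1 / (N + 2) is at most the increment of ln, and over that increment the power drops at least at
   the rate given by its smaller end value. *)
have h := lnS_sub_ge N.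
apply: le_trans (subrX_ge _ (cN _ _) _) => //; last first.
  by rewrite lerD2l lerN2 -subr_ge0 (le_trans _ h).
rewrite mulrC mulrA; apply: ler_wpM2l.
  by rewrite mulr_ge0 ?exprn_ge0 ?cN.
by apply: le_trans h _; rewrite opprB addrACA [- _ + _]addrC addrACA subrr add0r.
Qed.

(** A real x >= N is allowed because the induction passes to x / (i + 1), while the integer argument
    is rounded down. The shift in the logarithm grows by 1 per dimension to absorb the boundary term
    c^d of [sum_pow_ln_le]: (c + 1)^(d+1) >= c^(d+1) + (d + 1) c^d. *)
Lemma size_hcross_le d N x : N%:R <= x -> 1 <= x ->
  (size (hcross d.+1 N))%:R <= 2 ^+ d.+1 * x * (ln x + d%:R) ^+ d / d`!%:R.
Proof.
elim: d N x => [|d IH] N x Nx x1.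
  rewrite size_hcross1 expr1 expr0 fact0 divr1 mulr1.
  rewrite (@le_trans _ _ (N + N)%:R)// ?ler_nat ?leq_add2l ?leq_pred//.
  by rewrite natrD; lra.
have x0 : 0 < x by lra.
have L0 := ln_ge0 x1.
set c := ln x + d.+1%:R - 1.
have cE : c = ln x + d%:R by rewrite /c -natr1; ring.
have clnE i : (i < N)%N -> c - ln i.+1%:R = ln (x / i.+1%:R) + d%:R.
  by move=> iN; rewrite ln_div ?posrE// cE; ring.
have xi i : (i < N)%N -> 1 <= x / i.+1%:R.
  move=> iN; rewrite ler_pdivlMr// mul1r (le_trans _ Nx)//.
  by rewrite ler_nat.
have c_ge0 i : (i < N)%N -> 0 <= c - ln i.+1%:R.
  by move=> iN; rewrite clnE// addr_ge0// ln_ge0// xi.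
pose S := \sum_(i < N) (c - ln i.+1%:R) ^+ d / i.+1%:R.
have lS : S <= (ln x + d.+1%:R) ^+ d.+1 / d.+1%:R.
  have c0 : 0 <= c by rewrite cE addr_ge0.
  have -> : ln x + d.+1%:R = c + 1 by rewrite /c; ring.
  rewrite /S; case: (N) c_ge0 => [|M] c_ge0.
    by rewrite big_ord0 divr_ge0 ?exprn_ge0// addr_ge0.
  apply: le_trans (sum_pow_ln_le _ _) _ => //.
  rewrite -[X in X + _](mulfK (_ : d.+1%:R != 0)) ?pnatr_eq0// -mulrDl.
  rewrite ler_pM2r ?invr_gt0//.
  have := subrX_ge d c0 (_ : c <= c + 1); rewrite lerDl => /(_ ler01).
  have := exprn_ge0 d.+1 (c_ge0 M _); rewrite leqnn => /(_ isT).
  by rewrite [c + 1 - c]addrC addKr mulr1 mulrC; lra.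
have sumS : (\sum_(i < N) size (hcross d.+1 (N %/ i.+1)))%:R <=
  2 ^+ d.+1 * x / d`!%:R * S.
  rewrite natr_sum mulr_sumr ler_sum// => i _.
  have iN := ltn_ord i.
  rewrite clnE//; apply: le_trans (IH _ (x / i.+1%:R) _ (xi _ iN)) _.
    rewrite ler_pdivlMr// -natrM (le_trans _ Nx)// ler_nat.
    exact: leq_trunc_div.
  rewrite le_eqVlt; apply/orP; left; apply/eqP; field.
  by rewrite !lt0r_neq0// ltr0n ?fact_gt0.
(* Replacing the sum over k < 0 by the one over k >= 0 adds only the term k = 0 and produces the
   factor 2 of the new dimension. *)
have sum2 : (\sum_(i < N.-1) size (hcross d.+1 (N %/ i.+2)) <=
    \sum_(i < N) size (hcross d.+1 (N %/ i.+1)))%N.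
  by case: (N) => // M; rewrite [leqRHS]big_ord_recl leq_addl.
rewrite size_hcrossS natrD.
move: sum2; rewrite -(ler_nat R) => sum2.
apply: (@le_trans _ _ (2 * (2 ^+ d.+1 * x / d`!%:R * S))); first by lra.
have -> : 2 ^+ d.+2 * x * (ln x + d.+1%:R) ^+ d.+1 / d.+1`!%:R =
    2 * (2 ^+ d.+1 * x / d`!%:R * ((ln x + d.+1%:R) ^+ d.+1 / d.+1%:R)).
  by rewrite [2 ^+ d.+2]exprS factS natrM invfM; ring.
by rewrite ler_wpM2l// ler_wpM2l// divr_ge0// mulr_ge0// ltW.
Qed.

(** One step of the telescoping comparison from below. The cut-off at 0 lets the telescope run past
    the index where ln (i + 2) exceeds c. *)
Lemma pow_ln_step d i (c : R) : 0 <= c - ln i.+1%:R ->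
  Num.max 0 (c - ln i.+1%:R) ^+ d.+1 - Num.max 0 (c - ln i.+2%:R) ^+ d.+1 <=
  d.+1%:R * ((c - ln i.+1%:R) ^+ d / i.+1%:R).
Proof.
move=> c0; rewrite max_r//.
have h := lnS_sub_le i.
have m0 : 0 <= Num.max 0 (c - ln i.+2%:R) by rewrite le_max lexx.
have le_w : Num.max 0 (c - ln i.+2%:R) <= c - ln i.+1%:R.
  by rewrite ge_max c0 lerD2l lerN2 ler_ln ?posrE//= ler_nat ltnW.
apply: le_trans (subrX_le _ m0 le_w) _.
rewrite -mulrA ler_wpM2l// ler_wpM2l ?exprn_ge0//.
apply: le_trans h; rewrite lerBlDl -lerBlDr.
rewrite (_ : _ - (ln _ - _) = c - ln i.+2%:R); last by ring.
by rewrite le_max lexx orbT.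
Qed.

(** The factor 1 - e is spent at d = 0 only. Each further step drops the frequency k = 0 and starts
    the comparison at |k| + 1 = 2, which raises the shift b by ln 2. The condition r <= N + 1
    survives rounding: r / (i + 2) is at most the integer part of N / (i + 2) plus 1. *)
Lemma size_hcross_ge_asymp (e : R) d : 0 < e -> e <= 1 -> exists2 b, 0 <= b &
  forall N r, r <= N.+1%:R -> 0 < r -> b <= ln r ->
  (1 - e) * 2 ^+ d.+1 * r * (ln r - b) ^+ d / d`!%:R <= (size (hcross d.+1 N))%:R.
Proof.
move=> e0 e1; elim: d => [|d [b b0 IH]].
  (* The count is at least 2 N - 1 >= 2 r - 3, and this is at least 2 (1 - e) r once r >= 3 / (2
     e). *)
  exists (3 / (2 * e)); first by rewrite divr_ge0// mulr_ge0// ltW.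
  move=> N r rN r0 br; rewrite expr0 fact0 divr1 mulr1 expr1 size_hcross1.
  have : 3 / (2 * e) <= r by rewrite (le_trans br)// ltW// ln_sublinear.
  rewrite ler_pdivrMr ?mulr_gt0// => h.
  have : (N + N)%:R - 1 <= (N + N.-1)%:R :> R.
    by rewrite lerBlDr -[X in _ + X]/(1%:R) -natrD ler_nat; lia.
  by move: rN; rewrite natrD -natr1; lra.
exists (b + ln 2); first by rewrite addr_ge0// ln_ge0// ler1n.
move=> N r rN r0 br.
have ln2_ge0 : 0 <= ln 2 :> R by rewrite ln_ge0// ler1n.
have N0 : (0 < N)%N.
  rewrite lt0n; apply/eqP => N0; move: rN; rewrite N0 => r1.
  have : 0 < ln 2 :> R by rewrite ln_gt0// ltr1n.
  by have := ln_le0 r1; lra.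
pose c := ln r - b; pose w i : R := Num.max 0 (c - ln i.+1%:R) ^+ d.+1.
pose K := (1 - e) * 2 ^+ d.+1 * r / d.+1`!%:R.
have term i : (i < N.-1)%N ->
    K * (w i.+1 - w i.+2) <= (size (hcross d.+1 (N %/ i.+2)))%:R.
  move=> iN; have i2 : 0 < i.+2%:R :> R by [].
  have K0 : 0 <= K by rewrite divr_ge0// !mulr_ge0 ?exprn_ge0//; lra.
  case: (leP 0 (c - ln i.+2%:R)) => ci; last first.
    rewrite (le_trans _ (ler0n _ _))// mulr_ge0_le0// /w.
    rewrite (max_l (ltW ci)) exprS mul0r sub0r oppr_le0 exprn_ge0//.
    by rewrite le_max lexx.
  have ri : 0 < r / i.+2%:R by rewrite divr_gt0.
  have lnri : ln (r / i.+2%:R) = ln r - ln i.+2%:R by rewrite ln_div ?posrE.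
  apply: le_trans (IH _ (r / i.+2%:R) _ _ _) => //; last first.
  - by rewrite lnri; move: ci; rewrite /c; lra.
  - rewrite ler_pdivrMr// (le_trans rN)// -natrM ler_nat.
    exact: ltn_ceil.
  apply: le_trans (ler_wpM2l K0 (pow_ln_step d ci)) _.
  rewrite lnri (_ : ln r - _ - b = c - ln i.+2%:R); last by rewrite /c; ring.
  rewrite le_eqVlt; apply/orP; left; apply/eqP.
  rewrite /K factS natrM invfM; field.
  by rewrite !lt0r_neq0// ltr0n ?fact_gt0.
(* The far end of the telescope is cut off to 0, since c <= ln r <= ln (N + 1). *)
have telesc : \sum_(i < N.-1) K * (w i.+1 - w i.+2) = K * w 1%N.
  rewrite -mulr_sumr; congr (_ * _).
  rewrite -(big_mkord predT (fun i => w i.+1 - w i.+2)).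
  rewrite (telescope_sumr_eq (fun i => - w i.+1)) // => [|k _].
    rewrite opprK prednK// /w (max_l (_ : c - ln N.+1%:R <= 0)).
      by rewrite exprS mul0r oppr0 add0r.
    have : ln r <= ln N.+1%:R by rewrite ler_ln ?posrE.
    by rewrite /c; lra.
  by rewrite opprK addrC.
have K0 : 0 <= K * w 1%N.
  by rewrite mulr_ge0// ?exprn_ge0 ?le_max ?lexx// divr_ge0// !mulr_ge0 ?exprn_ge0//; lra.
have : K * w 1%N <= \sum_(i < N.-1) (size (hcross d.+1 (N %/ i.+2)))%:R.
  by rewrite -telesc ler_sum// => i _; exact: term.
rewrite -natr_sum => h.
(* Without the term k = 0 both sums equal the same A, whence the factor 2. *)
rewrite size_hcrossS -[in X in (X + _)%N](prednK N0) big_ord_recl /= addnAC.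
set A := (\sum_(i < N.-1) _)%N in h *.
rewrite (_ : (\sum_(i < N.-1) _)%N = A); last first.
  by apply: eq_bigr => i _; rewrite prednK.
rewrite natrD (@le_trans _ _ (A + A)%:R)//; last first.
  by rewrite -natrD ler_nat -addnA leq_addl.
rewrite natrD; apply: le_trans (lerD h h).
have -> : w 1%N = (ln r - (b + ln 2)) ^+ d.+1.
  by rewrite /w max_r /c; [congr (_ ^+ _); ring|lra].
by rewrite le_eqVlt; apply/orP; left; apply/eqP; rewrite /K [2 ^+ d.+2]exprS; ring.
Qed.
End counting_bounds.

(** * Asymptotic inversion of the counting function *)

Section counting_asymptotics.
Context {R : realType}.
Implicit Types (d N : nat).

Lemma cvgr_inv_pinfty : x^-1 @[x --> +oo%R] --> (0 : R).
Proof.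
apply/(gtr0_cvgV0 (f := id)); last exact: cvg_id.
exact: nbhs_pinfty_gt.
Qed.

Lemma cvgr_pow_1Ddiv (k : R) d : (1 + k / x) ^+ d @[x --> +oo%R] --> (1 : R).
Proof.
have h : 1 + k / x @[x --> +oo] --> 1 + k * 0.
  by apply: cvgD; [exact: cvg_cst|apply: cvgMl_tmp; exact: cvgr_inv_pinfty].
have := cvg_comp _ _ h (@exprn_continuous R d _).
by rewrite mulr0 addr0 expr1n.
Qed.

Lemma ln_le_sqrt (x : R) : 0 < x -> ln x <= 2 * Num.sqrt x.
Proof.
move=> x0; rewrite -[in leLHS](sqr_sqrtr (ltW x0)) lnXn ?sqrtr_gt0//.
by rewrite -(mulr_natl (ln _)) ler_wpM2l// ltW// ln_sublinear// sqrtr_gt0.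
Qed.

Lemma cvgr_ln_div (k : R) : ln (x + k) / x @[x --> +oo%R] --> (0 : R).
Proof.
have cvg_sqrt : 4 * (Num.sqrt x)^-1 @[x --> +oo%R] --> (0 : R).
  rewrite -(mulr0 4); apply: cvgMl_tmp.
  apply/(gtr0_cvgV0 (f := Num.sqrt)).
    near=> x; rewrite sqrtr_gt0; near: x; exact: nbhs_pinfty_gt.
  apply/cvgryPge => A; near=> x.
  have Ax : A ^+ 2 <= x by near: x; apply: nbhs_pinfty_ge; rewrite num_real.
  by rewrite (le_trans (ler_norm A))// -sqrtr_sqr ler_wsqrtr.
apply: (squeeze_cvgr (f := cst 0) _ _ cvg_sqrt); last exact: cvg_cst.
near=> x.
have x0 : 0 < x by near: x; exact: nbhs_pinfty_gt.
have x1 : 1 - k <= x by near: x; apply: nbhs_pinfty_ge; rewrite num_real.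
have xk : k <= x by near: x; apply: nbhs_pinfty_ge; rewrite num_real.
have xk1 : 1 <= x + k by lra.
rewrite divr_ge0 ?ln_ge0 ?(ltW x0)//= ler_pdivrMr//.
have -> : 4 / Num.sqrt x * x = 4 * Num.sqrt x.
  have s0 : Num.sqrt x != 0 by rewrite gt_eqF// sqrtr_gt0.
  by rewrite -[X in _ * X = _](sqr_sqrtr (ltW x0)); field.
apply: le_trans (ln_le_sqrt _) _; first by lra.
have -> : 4 * Num.sqrt x = 2 * (2 * Num.sqrt x) by ring.
rewrite ler_wpM2l//.
rewrite -[X in X * Num.sqrt x]ger0_norm// -sqrtr_sqr.
by rewrite -sqrtrM ?exprn_ge0// ler_wsqrtr//; lra.
Unshelve. all: by end_near. Qed.

Lemma leq_size_hcross d N M : (N <= M)%N -> (size (hcross d N) <= size (hcross d M))%N.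
Proof.
move=> NM; apply: uniq_leq_size (hcross_uniq _ _) _ => k.
by rewrite !mem_hcross => /leq_trans; exact.
Qed.

(** Here m inverts the counting function. The quotient is first treated with ln m in place of ln n,
    where the counting bounds apply directly; then ln n / ln m is shown to tend to 1. *)
Lemma cvg_size_hcross_inv d (m : nat -> nat) :
  (forall n, (0 < n)%N ->
    (size (hcross d.+1 (m n).-1) < n <= size (hcross d.+1 (m n)))%N) ->
  n%:R / ((m n)%:R * ln n%:R ^+ d) @[n --> \oo] --> (2 ^+ d.+1 / d`!%:R : R).
Proof.
move=> mP; set c : R := _ / _.
have c0 : 0 < c by rewrite divr_gt0 ?exprn_gt0// ltr0n fact_gt0.
have m_le n : (0 < n)%N -> (m n <= n)%N.
  move=> /mP/andP[+ _]; have := size_hcross_ge d (m n).-1; lia.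
pose y n : R := ln (m n)%:R.
have m_gt0 n : (0 < n)%N -> (0 < m n)%N.
  move=> n0; have /andP[_] := mP _ n0; case: (m n) => //.
  by rewrite hcross_nil leqNgt n0.
have m_oo K : \forall n \near \oo, (K < m n)%N.
  exists (size (hcross d.+1 K)).+1 => // n /= Kn.
  have /andP[_] := mP n (leq_trans (ltn0Sn _) Kn).
  rewrite ltnNge; apply: contraTN => /leq_size_hcross mK.
  by rewrite -ltnNge (leq_ltn_trans (mK d.+1)).
have y_oo : y n @[n --> \oo] --> +oo.
  apply/cvgryPge => A; near=> n.
  have : (`|Num.ceil (expR A)| < m n)%N by near: n; exact: m_oo.
  rewrite -(ltr_nat R) => lt_m.
  rewrite -[A]expRK /y ler_ln ?posrE ?expR_gt0//; last exact: le_lt_trans lt_m.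
  apply: le_trans (ltW lt_m); apply: le_trans (ceil_ge _) _.
  by rewrite natr_absz ler_int ler_norm.
have y_gt0 : \forall n \near \oo, 0 < y n by exact: cvgry_gt.
have le_n n : (0 < n)%N -> n%:R <= c * (m n)%:R * (y n + d%:R) ^+ d.
  move=> n0; have /andP[_] := mP _ n0; rewrite -(ler_nat R) => /le_trans; apply.
  apply: le_trans (size_hcross_le d (lexx _) _) _; first by rewrite ler1n m_gt0.
  by rewrite /c le_eqVlt; apply/orP; left; apply/eqP; rewrite /y; ring.
pose r n : R := n%:R / ((m n)%:R * y n ^+ d).
have r_c : r n @[n --> \oo] --> c.
  apply/cvgrPdist_le => e e0.
  have up : \forall n \near \oo, r n < c + e.
    have : c * (1 + d%:R / y n) ^+ d @[n --> \oo] --> c.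
      rewrite -[X in _ --> X]mulr1; apply: cvgMl_tmp.
      exact: (cvg_comp _ _ y_oo (cvgr_pow_1Ddiv _ _)).
    move=> /cvgr_lt/(_ (c + e)); rewrite ltrDl => /(_ e0) lt_e.
    near=> n; have n0 : (0 < n)%N by near: n; exact: nbhs_infty_gt.
    have yn : 0 < y n by near: n.
    apply: (@le_lt_trans _ _ (c * (1 + d%:R / y n) ^+ d)); last by near: n.
    rewrite /r ler_pdivrMr ?mulr_gt0 ?exprn_gt0 ?ltr0n ?m_gt0//.
    apply: le_trans (le_n _ n0) _.
    rewrite -mulrA -[leRHS]mulrA ler_pM2l// mulrCA ler_wpM2l//.
    by rewrite -exprMn mulrDl mul1r mulfVK// gt_eqF.
  (* Chosen so that (1 - h) c is still above c - e. *)
  pose h := Num.min 1 (e / (2 * c)).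
  have h0 : 0 < h by rewrite lt_min ltr01 divr_gt0// mulr_gt0.
  have h1 : h <= 1 by rewrite ge_min lexx.
  have hc : h * c <= e / 2.
    by rewrite -ler_pdivlMr// -mulrA -invfM ge_min lexx orbT.
  have [b b0 geb] := size_hcross_ge_asymp d h0 h1.
  have low : \forall n \near \oo, c - e < r n.
    have : (1 - h) * c * (1 + (- b) / y n) ^+ d @[n --> \oo] --> (1 - h) * c.
      rewrite -[X in _ --> X]mulr1; apply: cvgMl_tmp.
      exact: (cvg_comp _ _ y_oo (cvgr_pow_1Ddiv _ _)).
    move=> /cvgr_gt/(_ (c - e)) lt_e.
    have {}lt_e := lt_e ltac:(lra).
    near=> n; have n0 : (0 < n)%N by near: n; exact: nbhs_infty_gt.
    have yn : 0 < y n by near: n.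
    apply: (@lt_le_trans _ _ ((1 - h) * c * (1 - b / y n) ^+ d)).
      by rewrite -mulNr; near: n.
    rewrite /r ler_pdivlMr ?mulr_gt0 ?exprn_gt0 ?ltr0n ?m_gt0//.
    have /andP[/ltnW + _] := mP _ n0; rewrite -(ler_nat R); apply: le_trans.
    (* The lower counting bound is used at N = m - 1 and r = m, the extreme case r = N + 1. *)
    apply: le_trans (geb _ (m n)%:R _ _ _); last first.
    - by rewrite -/(y n); near: n; exact: cvgry_ge.
    - by rewrite ltr0n m_gt0.
    - by rewrite prednK ?m_gt0.
    have <- : (1 - b / y n) ^+ d * y n ^+ d = (ln (m n)%:R - b) ^+ d.
      by rewrite -exprMn mulrBl mul1r mulfVK// gt_eqF.
    by rewrite /c le_eqVlt; apply/orP; left; apply/eqP; ring.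
  near=> n; rewrite ler_norml.
  have : r n < c + e by near: n.
  have : c - e < r n by near: n.
  by lra.
(* From below by m <= n; from above by the logarithm of [le_n], that is ln n <= ln c + y + d ln (y +
   d). *)
have q_1 : ln n%:R / y n @[n --> \oo] --> (1 : R).
  have : 1 + (ln c / y n + d%:R * (ln (y n + d%:R) / y n)) @[n --> \oo] --> (1 : R).
    rewrite -[X in _ --> X]addr0; apply: cvgD; first exact: cvg_cst.
    rewrite -[X in _ --> X]addr0; apply: cvgD.
      rewrite -(mulr0 (ln c)); apply: cvgMl_tmp.
      exact: (cvg_comp _ _ y_oo cvgr_inv_pinfty).
    rewrite -(mulr0 d%:R); apply: cvgMl_tmp.
    by apply: (cvg_comp _ _ y_oo (cvgr_ln_div _)).
  apply: (squeeze_cvgr (f := cst 1)); last exact: cvg_cst.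
  near=> n; have n0 : (0 < n)%N by near: n; exact: nbhs_infty_gt.
  have yn : 0 < y n by near: n.
  have mn : 0 < (m n)%:R :> R by rewrite ltr0n m_gt0.
  have le_y : y n <= ln n%:R by rewrite ler_ln ?posrE ?ltr0n ?m_gt0// ler_nat m_le.
  rewrite /= ler_pdivlMr// mul1r le_y /=.
  rewrite ler_pdivrMr// mulrDl mul1r mulrDl mulfVK ?gt_eqF// mulrA mulfVK ?gt_eqF//.
  have yd : 0 < y n + d%:R by rewrite ltr_wpDr.
  have := le_n _ n0; rewrite -ler_ln ?posrE ?ltr0n ?mulr_gt0 ?exprn_gt0//.
  rewrite !lnM ?posrE ?mulr_gt0 ?exprn_gt0// lnXn// -/(y n) -(mulr_natl (ln (_ + _))).
  by rewrite [X in _ -> _ <= X]addrC addrAC.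
have : r n / (ln n%:R / y n) ^+ d @[n --> \oo] --> c / 1 ^+ d.
  apply: cvgM => //; apply: cvgV; first by rewrite expr1n oner_neq0.
  exact: (cvg_comp _ _ q_1 (@exprn_continuous R d _)).
rewrite expr1n divr1.
apply: cvg_trans; apply: near_eq_cvg; near=> n.
have yn : 0 < y n by near: n.
rewrite /r expr_div_n invf_div !invfM.
have yd : y n ^+ d != 0 by rewrite expf_neq0// gt_eqF.
by rewrite -[RHS]mulr1 -(divff yd); ring.
Unshelve. all: by end_near. Qed.

End counting_asymptotics.
(** * Integrals of characters over the torus *)

Section circle.
Context {R : realType}.
Local Notation circle := (@circle_measure R).

Lemma bounded_integrable_lty d (T : measurableType d)
    (mu : {measure set T -> \bar R}) (f : T -> R) (M : R) :
  (mu setT < +oo)%E -> measurable_fun setT f -> (forall x, `|f x| <= M) ->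
  mu.-integrable setT (EFin \o f).
Proof.
move=> muT mf fM; apply: measurable_bounded_integrable => //.
exists M; split=> [|m Mm x _]; first by rewrite num_real.
exact: le_trans (fM x) (ltW Mm).
Qed.

Lemma bounded_integrable d (T : measurableType d)
    (mu : {finite_measure set T -> \bar R}) (f : T -> R) (M : R) :
  measurable_fun setT f -> (forall x, `|f x| <= M) ->
  mu.-integrable setT (EFin \o f).
Proof. by apply: bounded_integrable_lty; rewrite ltey_eq fin_num_measure. Qed.

Lemma pi2_gt0 : 0 < 2 * pi :> R.
Proof. by rewrite mulr_gt0// pi_gt0. Qed.

Lemma circle_measure_setC : circle (~` `[0, 2 * pi]%classic) = 0%E.
Proof. by rewrite /circle_measure /mrestr setICl measure0. Qed.

Lemma circle_measure_set1 (a : R) : circle [set a] = 0%E.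
Proof.
apply/eqP; rewrite eq_le measure_ge0 andbT /circle_measure /mrestr.
rewrite -[leRHS](@lebesgue_measure_set1 R a); apply: le_measure.
- by rewrite inE; exact: measurableI.
- by rewrite inE.
- exact: subIsetl.
Qed.

(** [circle_measure] lives on the whole line; this passes to Lebesgue measure on one period, where
    the fundamental theorem of calculus applies. *)
Lemma integral_circle (f : R -> \bar R) : circle.-integrable setT f ->
  (\int[circle]_x f x = \int[@lebesgue_measure R]_(x in `[0%R, (2 * pi)%R]) f x)%E.
Proof.
move=> itf; rewrite (negligible_integral _ _ itf circle_measure_setC)//.
  rewrite setTD setCK; apply: eq_measure_integral => A _ AI.
  by rewrite /= /circle_measure /mrestr setIidl.
exact: measurableC.
Qed.

Lemma cos_sin_int2pi (k : int) :
  cos (k%:~R * (2 * pi)) = 1 :> R /\ sin (k%:~R * (2 * pi)) = 0 :> R.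
Proof.
have pos n : cos (n%:R * (2 * pi)) = 1 :> R /\ sin (n%:R * (2 * pi)) = 0 :> R.
  have -> : n%:R * (2 * pi) = 0 + pi *+ 2 *+ n :> R by rewrite add0r !mulr_natl.
  by rewrite (periodicn (@cosD2pi R)) (periodicn (@sinD2pi R)) cos0 sin0.
case: k => n; first exact: pos.
by have [c1 s0] := pos n.+1; rewrite NegzE mulrNz mulNr cosN sinN c1 s0 oppr0.
Qed.

Lemma integral_deriv_circle (f F : R -> R) : continuous f ->
  circle.-integrable setT (EFin \o f) -> (forall x, is_derive x (1 : R) F (f x)) ->
  (\int[circle]_x (f x)%:E = (F (2 * pi) - F 0)%:E)%E.
Proof.
move=> cf itf dF; rewrite (integral_circle itf).
have cF x : {for x, continuous F}.
  by apply: differentiable_continuous; apply/derivable1_diffP; have [] := dF x.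
rewrite (continuous_FTC2 pi2_gt0 (F := F))//.
- exact: continuous_subspaceT.
- split=> [x _| |]; first by have [] := dF x.
  + exact/cvg_at_right_filter/cF.
  + exact/cvg_at_left_filter/cF.
- by move=> x _; rewrite derive1E; have [_ ->] := dF x.
Qed.

Lemma integral_cos_sin (k : int) :
  (\int[circle]_x (cos (k%:~R * x))%:E = (if k == 0 then 2 * pi else 0)%:E)%E /\
  (\int[circle]_x (sin (k%:~R * x))%:E = 0)%E.
Proof.
have ck : continuous (fun x : R => k%:~R * x).
  by move=> x; apply: cvgMl_tmp; exact: cvg_id.
have cc : continuous (fun x : R => cos (k%:~R * x)).
  by move=> x; apply: continuous_comp; [exact: ck|exact: continuous_cos].
have cs : continuous (fun x : R => sin (k%:~R * x)).
  by move=> x; apply: continuous_comp; [exact: ck|exact: continuous_sin].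
have ic : circle.-integrable setT (EFin \o (fun x : R => cos (k%:~R * x))).
  apply: (@bounded_integrable _ _ _ _ 1).
    exact: continuous_measurable_fun.
  by move=> x; rewrite ler_norml cos_geN1 cos_le1.
have is_ : circle.-integrable setT (EFin \o (fun x : R => sin (k%:~R * x))).
  apply: (@bounded_integrable _ _ _ _ 1).
    exact: continuous_measurable_fun.
  by move=> x; rewrite ler_norml sin_geN1 sin_le1.
have [k0|k0] := eqVneq k 0.
  split.
    have dF x : is_derive x (1 : R) id (cos (k%:~R * x)).
      by rewrite k0 mul0r cos0; exact: is_derive_id.
    by rewrite (integral_deriv_circle cc ic dF) subr0.
  have dF x : is_derive x (1 : R) (cst (0 : R)) (sin (k%:~R * x)).
    by rewrite k0 mul0r sin0; exact: is_derive_cst.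
  by rewrite (integral_deriv_circle cs is_ dF) subr0.
have kR : k%:~R != 0 :> R by rewrite intr_eq0.
have [c1 s0] := cos_sin_int2pi k.
split.
  have dF x : is_derive x (1 : R) (fun x : R => k%:~R^-1 * sin (k%:~R * x))
      (cos (k%:~R * x)).
    by apply: is_derive_eq; rewrite /GRing.scale /=; field.
  by rewrite (integral_deriv_circle cc ic dF) s0 !mulr0 sin0 mulr0 subr0.
have dF x : is_derive x (1 : R) (fun x : R => - k%:~R^-1 * cos (k%:~R * x))
    (sin (k%:~R * x)).
  by apply: is_derive_eq; rewrite /GRing.scale /=; field.
by rewrite (integral_deriv_circle cs is_ dF) c1 !mulr0 cos0 subrr.
Qed.

End circle.

(** * From the circle to the torus: null coordinate sets and Fubini *)

Section torus_integrals.
Context {R : realType}.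
Local Notation circle := (@circle_measure R).
Local Notation mu := (@torus_measure R _).

Lemma torus_measure_coord d (j : 'I_d) (N : set R) : measurable N ->
  circle N = 0%E -> @torus_measure R d [set x | N (tnth x j)] = 0%E.
Proof.
move=> mN N0; elim: d j => [[]//|d IH] j.
rewrite /= /torus_measure_step /pushforward.
have [i ->|->] := unliftP ord0 j.
  rewrite (_ : _ @^-1` _ = setT `*` [set y : torus R d | N (tnth y i)]).
    rewrite product_measure1E//.
      by rewrite -(mule0 (circle setT)); congr (_ * _)%E; exact: IH.
    rewrite -[X in measurable X]setTI; apply: measurable_tnth => //.
  by apply/seteqP; split=> -[x y] /=; rewrite tnthS//; case.
rewrite (_ : _ @^-1` _ = N `*` setT).
  rewrite product_measure1E//.
  by rewrite -(mul0e (@torus_measure R d setT)); congr (_ * _)%E; exact: N0.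
by apply/seteqP; split=> -[x y] /=; rewrite tnth0//; case.
Qed.

Lemma phase_cons d (z : int) (k : d.-tuple int) (x : R * d.-tuple R) :
  phase [tuple of z :: k] (torus_cons x) = z%:~R * x.1 + phase k x.2.
Proof.
rewrite /phase big_ord_recl !tnth0; congr (_ + _).
by apply: eq_bigr => i _; rewrite !tnthS.
Qed.

Lemma measurable_phase_pos d (k : d.-tuple int) : measurable_fun setT (@phase R d k).
Proof.
have := measurable_funN (measurable_phase (R := R) k).
by apply: eq_measurable_fun => x _ /=; rewrite opprK.
Qed.

Lemma measurable_cos_comp d (T : measurableType d) (f : T -> R) :
  measurable_fun setT f -> measurable_fun setT (cos \o f).
Proof.
by apply: measurableT_comp; apply: continuous_measurable_fun; exact: continuous_cos.
Qed.

Lemma measurable_sin_comp d (T : measurableType d) (f : T -> R) :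
  measurable_fun setT f -> measurable_fun setT (sin \o f).
Proof.
by apply: measurableT_comp; apply: continuous_measurable_fun; exact: continuous_sin.
Qed.

Lemma integrable_cos_comp d (T : measurableType d) (m : {finite_measure set T -> \bar R})
    (f : T -> R) : measurable_fun setT f -> m.-integrable setT (EFin \o (cos \o f)).
Proof.
move=> /measurable_cos_comp mf; apply: (@bounded_integrable _ _ _ _ _ 1) => // x.
by rewrite ler_norml cos_geN1 cos_le1.
Qed.

Lemma integrable_sin_comp d (T : measurableType d) (m : {finite_measure set T -> \bar R})
    (f : T -> R) : measurable_fun setT f -> m.-integrable setT (EFin \o (sin \o f)).
Proof.
move=> /measurable_sin_comp mf; apply: (@bounded_integrable _ _ _ _ _ 1) => // x.
by rewrite ler_norml sin_geN1 sin_le1.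
Qed.

Lemma integral_torusS d (f : torus R d.+1 -> R) (M : R) :
  measurable_fun setT f -> (forall x, `|f x| <= M) ->
  (\int[mu]_x (f x)%:E =
   \int[circle]_u \int[@torus_measure R d]_v (f (torus_cons (u, v)))%:E)%E.
Proof.
move=> mf fM.
have mc : measurable_fun setT (f \o @torus_cons R d).
  exact: measurableT_comp.
have prodT : ((circle \x @torus_measure R d) setT < +oo)%E.
  by rewrite -setXTT product_measure1E// ltey_eq fin_numM ?fin_num_measure.
have ifc : (circle \x @torus_measure R d)%E.-integrable setT
    (EFin \o (f \o @torus_cons R d)).
  by apply: (bounded_integrable_lty (M := M) prodT); [exact: mc|move=> x; exact: fM].
have mEf : measurable_fun setT (EFin \o f) by exact/measurable_EFinP.
have ifc' := ifc.
rewrite -[X in _.-integrable X](preimage_setT (@torus_cons R d)) in ifc'.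
have := integral_pushforward (measurable_torus_cons (R:=R) (n:=d)) mEf ifc' measurableT.
rewrite preimage_setT -(integral12_prod_meas1 ifc); exact.
Qed.

(** Both integrals are treated together since the addition formulas mix them. After the first
    frequency is split off, every product with a sine factor integrates to 0, so only the product of
    the two cosine integrals survives. *)
Lemma integral_cos_sin_phase d (k : d.-tuple int) :
  (\int[mu]_x (cos (phase k x))%:E =
    (if k == [tuple of nseq d 0] then (2 * pi) ^+ d else 0)%:E)%E /\
  (\int[mu]_x (sin (phase k x))%:E = 0)%E.
Proof.
elim: d k => [|d IH] k.
  have k0 x : phase k x = 0 by rewrite /phase big_ord0.
  split; under eq_integral do rewrite k0.
    have -> : k == [tuple of nseq 0 0] by apply/eqP/val_inj; rewrite (tuple0 k).
    by rewrite cos0 integral_dirac// diracT mul1e expr0.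
  by rewrite sin0 integral0.
case/tupleP: k => z k; have [Ic Is] := IH k; have [Jc Js] := @integral_cos_sin R z.
have mph := measurable_phase_pos k.
have ic := integrable_cos_comp (@torus_measure R d) mph.
have is_ := integrable_sin_comp (@torus_measure R d) mph.
have mz : measurable_fun setT (fun u : R => z%:~R * u).
  by apply: measurable_funM => //; exact: measurable_cst.
have jc := integrable_cos_comp circle mz.
have js := integrable_sin_comp circle mz.
set c := (if _ then (2 * pi) ^+ d else 0) in Ic.
have kE : ([tuple of z :: k] == [tuple of nseq d.+1 0]) =
    (z == 0) && (k == [tuple of nseq d 0]).
  by rewrite -!val_eqE /= eqseq_cons.
split.
- rewrite (@integral_torusS _ _ 1) => [||x]; last 2 first.
  + exact: measurable_cos_comp (measurable_phase_pos _).
  + by rewrite ler_norml cos_geN1 cos_le1.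
  transitivity (\int[circle]_u (c%:E * (cos (z%:~R * u))%:E))%E.
    apply: eq_integral => u _; under eq_integral do
      rewrite phase_cons cosD EFinB !EFinM.
    rewrite integralB//=; [|exact: integrableZl|exact: integrableZl].
    by rewrite !integralZl// Ic Is mule0 sube0 muleC.
  rewrite integralZl// Jc kE /c -EFinM; congr EFin.
  by case: (z == 0); case: (k == _); rewrite /= ?mulr0 ?mul0r// exprSr.
- rewrite (@integral_torusS _ _ 1) => [||x]; last 2 first.
  + exact: measurable_sin_comp (measurable_phase_pos _).
  + by rewrite ler_norml sin_geN1 sin_le1.
  transitivity (\int[circle]_u (c%:E * (sin (z%:~R * u))%:E))%E.
    apply: eq_integral => u _; under eq_integral do
      rewrite phase_cons sinD EFinD !EFinM.
    rewrite integralD//=; [|exact: integrableZl|exact: integrableZl].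
    by rewrite !integralZl// Ic Is mule0 adde0 muleC.
  by rewrite integralZl// Js mule0.
Qed.

End torus_integrals.
(** * Density of trigonometric polynomials in L2 *)

Section trigonometric_density.
Context {R : realType} {d : nat}.
Local Notation T := (torus R d).
Local Notation normc := Normc.normc.
Local Open Scope complex_scope.
Implicit Types (f g P Q : T -> R[i]).

Definition expk (k : d.-tuple int) (x : T) : R[i] := expi (phase k x).

(** Frequencies may repeat, which makes sums and products free of bookkeeping; [trig_polyP] merges
    them afterwards. *)
Inductive trig_poly : (T -> R[i]) -> Prop :=
| Trig0 : trig_poly (fun=> 0)
| TrigD a k P : trig_poly P -> trig_poly (fun x => a * expk k x + P x).

Lemma expiD (s t : R) : expi (s + t) = expi s * expi t.
Proof. by rewrite /expi cosD sinD; simpc; rewrite [cos s * sin t + _]addrC. Qed.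

Lemma expi0 : expi 0 = 1 :> R[i].
Proof. by rewrite /expi cos0 sin0. Qed.

Lemma phaseD (k l : d.-tuple int) (x : T) :
  phase [tuple tnth k j + tnth l j | j < d] x = phase k x + phase l x.
Proof.
by rewrite -big_split; apply: eq_bigr => j _; rewrite tnth_mktuple rmorphD mulrDl.
Qed.

Lemma trig_poly_eq P Q : P =1 Q -> trig_poly P -> trig_poly Q.
Proof. by move=> /funext ->. Qed.

Lemma trig_polyD P Q : trig_poly P -> trig_poly Q -> trig_poly (fun x => P x + Q x).
Proof.
move=> + tQ; elim=> [|a k {}P tP IH].
  by apply: trig_poly_eq tQ => x; rewrite add0r.
by apply: trig_poly_eq (TrigD a k IH) => x; rewrite addrA.
Qed.

Lemma trig_polyZ a P : trig_poly P -> trig_poly (fun x => a * P x).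
Proof.
elim=> [|b k {}P tP IH].
  by apply: trig_poly_eq Trig0 => x; rewrite mulr0.
by apply: trig_poly_eq (TrigD (a * b) k IH) => x; rewrite mulrDr mulrA.
Qed.

Lemma trig_polyM P Q : trig_poly P -> trig_poly Q -> trig_poly (fun x => P x * Q x).
Proof.
move=> + tQ; elim=> [|a k {}P tP IH].
  by apply: trig_poly_eq Trig0 => x; rewrite mul0r.
suff /trig_polyD/(_ IH) : trig_poly (fun x => a * expk k x * Q x).
  by apply: trig_poly_eq => x; rewrite mulrDl.
elim: tQ {IH} => [|b l {}Q tQ IHQ].
  by apply: trig_poly_eq Trig0 => x; rewrite mulr0.
apply: trig_poly_eq (TrigD (a * b) [tuple tnth k j + tnth l j | j < d] IHQ) => x.
by rewrite /expk phaseD expiD mulrDr mulrACA.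
Qed.

Lemma trig_poly_cst a : trig_poly (fun=> a).
Proof.
apply: trig_poly_eq (TrigD a [tuple of nseq d 0] Trig0) => x.
rewrite /expk (_ : phase _ x = 0) ?expi0 ?mulr1 ?addr0//.
by rewrite /phase big1// => j _; rewrite tnth_nseq mul0r.
Qed.

Lemma trig_polyX n P : trig_poly P -> trig_poly (fun x => P x ^+ n).
Proof.
move=> tP; elim: n => [|n IH]; first exact: trig_poly_cst.
by apply: trig_poly_eq (trig_polyM tP IH) => x; rewrite exprS.
Qed.

Lemma trig_poly_expk k : trig_poly (expk k).
Proof. by apply: trig_poly_eq (TrigD 1 k Trig0) => x; rewrite mul1r addr0. Qed.

Definition axis (j : 'I_d) (z : int) : d.-tuple int :=
  [tuple if i == j then z else 0 | i < d].

Lemma phase_axis j z (x : T) : phase (axis j z) x = z%:~R * tnth x j.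
Proof.
rewrite /phase (bigD1 j)//= tnth_mktuple eqxx big1 ?addr0// => i ij.
by rewrite tnth_mktuple (negPf ij) mul0r.
Qed.

Lemma trig_poly_cos j a : trig_poly (fun x => (cos (tnth x j - a))%:C).
Proof.
have h := trig_polyD (trig_polyZ (expi (- a) / 2) (trig_poly_expk (axis j 1)))
  (trig_polyZ (expi a / 2) (trig_poly_expk (axis j (-1)))).
apply: trig_poly_eq h => x.
rewrite /expk !phase_axis mul1r mulN1r.
rewrite mulrAC [X in _ + X]mulrAC -!expiD -mulrDl.
rewrite [- a + _]addrC -[a - _]opprB /expi cosN sinN.
set c := cos _; set s := sin _.
have -> : (c +i* s) + (c -i* s) = c%:C * 2.
  by rewrite mulr_natr mulr2n; simpc.
by apply: mulfK; rewrite pnatr_eq0.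
Qed.

Lemma cmeasurableD f g : cmeasurable f -> cmeasurable g ->
  cmeasurable (fun x => f x + g x).
Proof.
move=> mf mg; have := cmeasurableZD 1 mf mg; rewrite scale1r; exact.
Qed.

Lemma cmeasurable_real (g : T -> R) : measurable_fun setT g ->
  cmeasurable (fun x => (g x)%:C).
Proof. by move=> mg; split => //=; exact: measurable_cst. Qed.

Lemma cmeasurableM f g : cmeasurable f -> cmeasurable g ->
  cmeasurable (fun x => f x * g x).
Proof.
move=> [fr fi] [gr gi]; split.
  under eq_fun do rewrite complexReM.
  by apply: measurable_funB; apply: measurable_funM.
under eq_fun do rewrite complexImM.
by apply: measurable_funD; apply: measurable_funM.
Qed.

Lemma cmeasurable_cst (a : R[i]) : cmeasurable (fun _ : T => a).
Proof. by split; exact: measurable_cst. Qed.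

Lemma cmeasurableB f g : cmeasurable f -> cmeasurable g ->
  cmeasurable (fun x => f x - g x).
Proof.
move=> mf mg; apply: cmeasurableD => //.
under eq_fun do rewrite -mulN1r.
by apply: cmeasurableM => //; exact: cmeasurable_cst.
Qed.

Lemma cmeasurable_expk k : cmeasurable (expk k).
Proof.
split; [exact: measurable_cos_comp (measurable_phase_pos k)|
        exact: measurable_sin_comp (measurable_phase_pos k)].
Qed.

Lemma cmeasurable_trig P : trig_poly P -> cmeasurable P.
Proof.
elim=> [|a k {}P _ IH]; first exact: cmeasurable_cst.
by apply: cmeasurableD => //; apply: cmeasurableM;
  [exact: cmeasurable_cst|exact: cmeasurable_expk].
Qed.

Lemma trig_poly_bounded P : trig_poly P ->
  exists2 M : R, 0 <= M & forall x, normc (P x) ^+ 2 <= M.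
Proof.
elim=> [|a k {}P _ [M M0 PM]].
  by exists 0 => // x; rewrite Normc.normc0 expr0n.
exists (2 * normc a ^+ 2 + 2 * M) => [|x].
  by rewrite addr_ge0// mulr_ge0// sqr_ge0.
apply: le_trans (sqr_normcD _ _) _.
by rewrite Normc.normcM exprMn normc_expi mulr1 lerD2l ler_wpM2l.
Qed.

End trigonometric_density.

(** * The L2 closure of the trigonometric polynomials *)

Section trigonometric_closure.
Context {R : realType} {d : nat}.
Local Notation T := (torus R d).
Local Notation mu := (@torus_measure R d).
Local Notation normc := Normc.normc.
Local Open Scope complex_scope.
Implicit Types (f g h P Q : T -> R[i]).

Definition sqint f : \bar R := (\int[mu]_x (normc (f x) ^+ 2)%:E)%E.

Definition trig_approx f := cmeasurable f /\
  forall e : R, 0 < e -> exists2 P, trig_poly P &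
    (sqint (fun x => (f x - P x)%R) <= e%:E)%E.

Lemma measurable_sqint f : cmeasurable f ->
  measurable_fun setT (fun x => (normc (f x) ^+ 2)%:E).
Proof. by move=> mf; apply/measurable_EFinP; exact: cmeasurable_normc. Qed.

Lemma le_sqint (c : R) f g : cmeasurable f -> cmeasurable g -> 0 <= c ->
  (forall x, normc (f x) ^+ 2 <= c * normc (g x) ^+ 2) ->
  (sqint f <= c%:E * sqint g)%E.
Proof.
move=> mf mg c0 fg; rewrite /sqint -ge0_integralZl//; last 2 first.
- exact: measurable_sqint.
- by move=> x _; rewrite lee_fin sqr_ge0.
apply: ge0_le_integral => //.
- by move=> x _; rewrite lee_fin sqr_ge0.
- exact: measurable_sqint.
- by apply: measurable_funeM; exact: measurable_sqint.
- by move=> x _; rewrite -EFinM lee_fin.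
Qed.

(** Works with squared norms in place of the triangle inequality; the factors 2 are the reason for
    the tolerances e / 4 below. *)
Lemma sqintD f g : cmeasurable f -> cmeasurable g ->
  (sqint (fun x => (f x + g x)%R) <= 2%:E * sqint f + 2%:E * sqint g)%E.
Proof.
move=> mf mg; have sq0 h x : (0 <= (normc (h x) ^+ 2)%:E)%E by rewrite lee_fin sqr_ge0.
rewrite /sqint -!ge0_integralZl//; try exact: measurable_sqint.
rewrite -ge0_integralD//; try by [move=> x _; rewrite mule_ge0//|
  apply: measurable_funeM; exact: measurable_sqint].
apply: ge0_le_integral => //.
- by move=> x _; rewrite lee_fin sqr_ge0.
- by apply: (measurable_sqint (f := fun x => (f x + g x)%R)); exact: cmeasurableD.
- by apply: emeasurable_funD; apply: measurable_funeM; exact: measurable_sqint.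
- by move=> x _; rewrite -!EFinM -EFinD lee_fin sqr_normcD.
Qed.

Lemma trig_approx_lim f : cmeasurable f ->
  (forall e : R, 0 < e -> exists2 g, trig_approx g &
    (sqint (fun x => (f x - g x)%R) <= e%:E)%E) -> trig_approx f.
Proof.
move=> mf fg; split=> // e e0; have e4 : 0 < e / 4 by rewrite divr_gt0.
have [g [mg gP] fg4] := fg _ e4; have [P tP gP4] := gP _ e4.
exists P => //; have mP := cmeasurable_trig tP.
rewrite (_ : (fun x => _) = fun x => (f x - g x) + (g x - P x)); last first.
  by apply/funext => x; rewrite addrA subrK.
apply: le_trans (sqintD (cmeasurableB mf mg) (cmeasurableB mg mP)) _.
have -> : e%:E = (2%:E * (e / 4)%:E + 2%:E * (e / 4)%:E)%E.
  by rewrite -!EFinM -EFinD; congr EFin; field.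
by apply: leeD; apply: lee_wpmul2l.
Qed.

Lemma trig_approx_trig P : trig_poly P -> trig_approx P.
Proof.
move=> tP; split=> [|e e0]; first exact: cmeasurable_trig.
exists P => //; rewrite /sqint; under eq_integral do rewrite subrr Normc.normc0 expr0n.
by rewrite integral0 lee_fin ltW.
Qed.

Lemma trig_approxD f g : trig_approx f -> trig_approx g ->
  trig_approx (fun x => f x + g x).
Proof.
move=> [mf fP] [mg gQ]; split=> [|e e0]; first exact: cmeasurableD.
have e4 : 0 < e / 4 by rewrite divr_gt0.
have [P tP fP4] := fP _ e4; have [Q tQ gQ4] := gQ _ e4.
exists (fun x => P x + Q x); first exact: trig_polyD.
have mP := cmeasurable_trig tP; have mQ := cmeasurable_trig tQ.
rewrite (_ : (fun x => _) = fun x => (f x - P x) + (g x - Q x)); last first.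
  by apply/funext => x; rewrite opprD addrACA.
apply: le_trans (sqintD (cmeasurableB mf mP) (cmeasurableB mg mQ)) _.
have -> : e%:E = (2%:E * (e / 4)%:E + 2%:E * (e / 4)%:E)%E.
  by rewrite -!EFinM -EFinD; congr EFin; field.
by apply: leeD; apply: lee_wpmul2l.
Qed.

Lemma trig_approxM_trig f Q : trig_approx f -> trig_poly Q ->
  trig_approx (fun x => f x * Q x).
Proof.
move=> [mf fP] tQ; have mQ := cmeasurable_trig tQ.
split=> [|e e0]; first exact: cmeasurableM.
have [M M0 QM] := trig_poly_bounded tQ.
have [|P tP fPe] := fP (e / (M + 1)); first by rewrite divr_gt0// ltr_wpDl.
exists (fun x => P x * Q x); first exact: trig_polyM.
have mP := cmeasurable_trig tP.
have -> : e%:E = ((M + 1)%:E * (e / (M + 1))%:E)%E.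
  by rewrite -EFinM mulrC divfK// gt_eqF// ltr_wpDl.
have M1 : 0 <= M + 1 by rewrite addr_ge0.
apply: le_trans (lee_wpmul2l _ fPe); last by rewrite lee_fin.
apply: le_sqint => //.
- by apply: cmeasurableB; exact: cmeasurableM.
- exact: cmeasurableB.
- move=> x; rewrite -mulrBl Normc.normcM exprMn mulrC ler_wpM2r ?sqr_ge0//.
  by rewrite (le_trans (QM x))// lerDl.
Qed.

(* Approximates g by a trigonometric polynomial Q first: f is bounded, so f Q is
   close to f g, and then Q is bounded, so that approximating f is enough. *)
Lemma trig_approxM f g (M : R) : trig_approx f -> trig_approx g ->
  (forall x, normc (f x) ^+ 2 <= M) -> trig_approx (fun x => f x * g x).
Proof.
move=> af [mg gQ] fM; have [mf _] := af.
apply: trig_approx_lim => [|e e0]; first exact: cmeasurableM.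
have M1 : 0 < M + 1.
  by rewrite ltr_wpDl// (le_trans (sqr_ge0 _) (fM point)).
have [|Q tQ gQe] := gQ (e / (M + 1)); first by rewrite divr_gt0.
have mQ := cmeasurable_trig tQ.
exists (fun x => f x * Q x); first exact: trig_approxM_trig.
have -> : e%:E = ((M + 1)%:E * (e / (M + 1))%:E)%E.
  by rewrite -EFinM mulrC divfK// gt_eqF.
apply: le_trans (lee_wpmul2l _ gQe); last by rewrite lee_fin ltW.
apply: le_sqint (ltW M1) _ => //.
- by apply: cmeasurableB; exact: cmeasurableM.
- exact: cmeasurableB.
- move=> x; rewrite -mulrBr Normc.normcM exprMn ler_wpM2r ?sqr_ge0//.
  by rewrite (le_trans (fM x))// lerDl.
Qed.

Lemma trig_approxZ a f : trig_approx f -> trig_approx (fun x => a * f x).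
Proof.
move=> af; apply: (@trig_approxM (fun=> a) f (normc a ^+ 2)) => //.
exact/trig_approx_trig/trig_poly_cst.
Qed.

(** Every pointwise limit in the density proof passes through this: step polynomials, increasing
    finite unions and simple functions. *)
Lemma trig_approx_dominated f (g : nat -> T -> R[i]) (h : T -> \bar R) :
  cmeasurable f -> (forall n, trig_approx (g n)) -> mu.-integrable setT h ->
  (forall n x, ((normc (f x - g n x)%R ^+ 2)%:E <= h x)%E) ->
  (\forall x \ae mu, normc (f x - g n x) ^+ 2 @[n --> \oo] --> (0 : R)) ->
  trig_approx f.
Proof.
move=> mf ag ih fgh fg0; apply: trig_approx_lim => // e e0.
have mfg n : measurable_fun setT (fun x => (normc (f x - g n x) ^+ 2)%:E).
  apply: (measurable_sqint (f := fun x => (f x - g n x)%R)).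
  by apply: cmeasurableB => //; have [] := ag n.
have [||_ _] := @dominated_convergence _ _ _ mu setT measurableT
  (fun n x => (normc (f x - g n x)%R ^+ 2)%:E) (cst 0%E) h mfg
  (measurable_cst _) _ ih _.
- by apply: filterS fg0 => x fgx _; apply: cvg_EFin => //; exact: nearW.
- by apply: aeW => x n _; rewrite gee0_abs ?lee_fin ?sqr_ge0.
rewrite integral0 => /fine_cvgP[fin /cvgrPdist_le/(_ e e0)] le_e.
near \oo => n; exists (g n); first exact: ag.
have finn : (\int[mu]_x (normc (f x - g n x)%R ^+ 2)%:E)%E \is a fin_num by near: n.
rewrite /sqint -(fineK finn) lee_fin.
rewrite -[leLHS]ger0_norm; last first.
  by rewrite fine_ge0// integral_ge0// => x _; rewrite lee_fin sqr_ge0.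
by rewrite -normrN -[X in `|X|]add0r; near: n.
Unshelve. all: by end_near. Qed.
End trigonometric_closure.

(** * Indicator functions of measurable sets *)

Section trigonometric_completeness.
Context {R : realType} {d : nat}.
Local Notation T := (torus R d).
Local Notation mu := (@torus_measure R d).
Local Notation circle := (@circle_measure R).
Local Notation normc := Normc.normc.
Local Open Scope complex_scope.
Implicit Types (f g h P Q : T -> R[i]).

Lemma exprBn_ge (m : nat) (y : R) : 0 <= y -> y <= 1 -> 1 - m%:R * y <= (1 - y) ^+ m.
Proof.
move=> y0 y1; elim: m => [|m IH]; first by rewrite mul0r subr0 expr0.
have y2 : 0 <= 1 - y by lra.
rewrite exprS; apply: le_trans (ler_wpM2l y2 IH).
have : 0 <= m%:R * y ^+ 2 by rewrite mulr_ge0// sqr_ge0.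
by rewrite -natr1; nra.
Qed.

Lemma exprDn_ge (m : nat) (y : R) : 0 <= y -> 1 + m%:R * y <= (1 + y) ^+ m.
Proof.
move=> y0; elim: m => [|m IH]; first by rewrite mul0r addr0 expr0.
have y2 : 0 <= 1 + y by lra.
rewrite exprS; apply: le_trans (ler_wpM2l y2 IH).
have : 0 <= m%:R * y ^+ 2 by rewrite mulr_ge0// sqr_ge0.
by rewrite -natr1; nra.
Qed.

(* The functions p |-> (1 - p^n)^(2^n) converge on [0, 1] to the indicator
   function of [0, 1/2[ (except at 1/2). *)
Definition step_poly n (p : R) := (1 - p ^+ n) ^+ (2 ^ n).

Lemma step_poly_itv n (p : R) : 0 <= p <= 1 -> 0 <= step_poly n p <= 1.
Proof.
move=> /andP[p0 p1]; have pn0 : 0 <= p ^+ n by rewrite exprn_ge0.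
have pn1 : p ^+ n <= 1 by rewrite exprn_ile1.
by rewrite exprn_ge0 ?exprn_ile1 ?subr_ge0 ?lerBlDr ?lerDl.
Qed.

(** Two uses of Bernoulli's inequality. If p < 1/2, the value is at least 1 - (2p)^n. If p > 1/2,
    its product with (1 + p^n)^(2^n) is at most 1, and that factor is at least (2p)^n, so the value
    is at most (2p)^(-n). *)
Lemma step_poly_cvg (p : R) : 0 <= p <= 1 -> p != 1 / 2 ->
  step_poly n p @[n --> \oo] --> ((p < 1 / 2)%R%:R : R).
Proof.
move=> p01 p12; have /andP[p0 p1] := p01.
have pn0 n : 0 <= p ^+ n by rewrite exprn_ge0.
have pn1 n : p ^+ n <= 1 by rewrite exprn_ile1.
case: (ltP p (1 / 2)) => [p_lt|]; last first.
  rewrite le_eqVlt eq_sym (negPf p12) /= => p_gt.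
  have q1 : `|(2 * p)^-1| < 1.
    by rewrite ger0_norm ?invr_ge0 ?mulr_ge0// invf_lt1; lra.
  apply: (squeeze_cvgr _ (cvg_cst (0 : R)) (cvg_expr q1)).
  near=> n; have /andP[-> _] := step_poly_itv n p01; rewrite /=.
  rewrite exprVn -[leRHS]mul1r ler_pdivlMr ?exprn_gt0//; last by lra.
  have le1 : (2 * p) ^+ n <= (1 + p ^+ n) ^+ (2 ^ n).
    apply: le_trans (exprDn_ge _ (pn0 n)).
    by rewrite exprMn natrX lerDr.
  apply: le_trans (ler_wpM2l _ le1) _; first by rewrite exprn_ge0// subr_ge0.
  rewrite -exprMn exprn_ile1//; first by rewrite mulr_ge0 ?subr_ge0 ?addr_ge0.
  by rewrite -subr_sqr expr1n lerBlDr lerDl sqr_ge0.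
have q1 : `|2 * p| < 1 by rewrite ger0_norm ?mulr_ge0//; lra.
have : 1 - (2 * p) ^+ n @[n --> \oo] --> (1 - 0 : R).
  by apply: cvgB; [exact: cvg_cst|exact: cvg_expr].
rewrite subr0 /= mulr1n => cvg1; apply: (squeeze_cvgr _ cvg1 (cvg_cst (1 : R))).
near=> n; have /andP[_ ->] := step_poly_itv n p01; rewrite andbT.
by rewrite exprMn -natrX; exact: exprBn_ge.
Unshelve. all: by end_near. Qed.

(** In the product, sin (x / 2) is positive inside the period and the other sine has the sign of a -
    x. *)
Lemma cosB_half (x a : R) :
  cos (x - a / 2) - cos (a / 2) = 2 * sin (x / 2) * sin ((a - x) / 2).
Proof.
rewrite (_ : x - a / 2 = x / 2 + - ((a - x) / 2)); last by field.
rewrite (_ : cos (a / 2) = cos (x / 2 + (a - x) / 2)); last by congr cos; field.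
by rewrite !cosD cosN sinN; ring.
Qed.

(** The arc from 0 to a has midpoint a / 2, and cos (a / 2) is the value of the shifted cosine at
    both ends. The difference lies in [-2, 2]; division by 4 and the shift bring it into [0, 1]. *)
Definition arc_poly (a x : R) := 1 / 2 - (cos (x - a / 2) - cos (a / 2)) / 4.

Lemma arc_poly_itv a x : 0 <= arc_poly a x <= 1.
Proof.
rewrite /arc_poly.
have := cos_le1 (x - a / 2); have := cos_geN1 (x - a / 2).
have := cos_le1 (a / 2); have := cos_geN1 (a / 2).
by move=> *; lra.
Qed.

Lemma arc_poly_lt (a x : R) : 0 < x < 2 * pi -> 0 <= a <= 2 * pi -> x != a ->
  arc_poly a x != 1 / 2 /\ (arc_poly a x < 1 / 2) = (x < a).
Proof.
move=> /andP[x0 x2] /andP[a0 a2] xa; rewrite /arc_poly cosB_half.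
have sx : 0 < sin (x / 2).
  by apply: sin_gt0_pi; apply/andP; split; lra.
case: (ltgtP x a) xa => // xa _.
  have sa : 0 < sin ((a - x) / 2) by apply: sin_gt0_pi; apply/andP; split; lra.
  have : 0 < sin (x / 2) * sin ((a - x) / 2) by rewrite mulr_gt0.
  by move=> h; split; [apply/eqP|]; lra.
have sa : 0 < sin ((x - a) / 2) by apply: sin_gt0_pi; apply/andP; split; lra.
have -> : (a - x) / 2 = - ((x - a) / 2) by field.
have : 0 < sin (x / 2) * sin ((x - a) / 2) by rewrite mulr_gt0.
rewrite sinN => h; split; [apply/eqP|apply/negbTE; rewrite -leNgt]; lra.
Qed.

Lemma normc_real (r : R) : normc r%:C ^+ 2 = r ^+ 2.
Proof. by rewrite sqr_normcE /= expr0n addr0. Qed.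

Lemma trig_arc_poly j a : trig_poly (fun x : T => (arc_poly a (tnth x j))%:C).
Proof.
have h := trig_polyD (trig_poly_cst (1 / 2 + cos (a / 2) / 4)%:C)
  (trig_polyZ (- (1 / 4))%:C (trig_poly_cos j (a / 2))).
apply: trig_poly_eq h => x; rewrite -rmorphM -rmorphD; congr _%:C.
by rewrite /arc_poly; field.
Qed.

Lemma trig_step_poly j a n :
  trig_poly (fun x : T => (step_poly n (arc_poly a (tnth x j)))%:C).
Proof.
have h := trig_polyX (2 ^ n) (trig_polyD (trig_poly_cst 1)
  (trig_polyZ (-1) (trig_polyX n (trig_arc_poly j a)))).
apply: trig_poly_eq h => x.
by rewrite /step_poly !(rmorphXn, rmorphB, rmorph1) mulN1r.
Qed.

Definition trig_set (E : set T) :=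
  measurable E /\ trig_approx (fun x => (\1_E x)%:C).

(** The excluded null set contains the ends of the period, where sin (x / 2) vanishes, and the
    threshold a, where [arc_poly] equals 1/2. *)
Lemma torus_ae_coord (j : 'I_d) (a : R) :
  \forall x \ae mu, 0 < tnth x j < 2 * pi /\ tnth x j != a.
Proof.
have ae_notin (N : set R) : measurable N -> circle N = 0%E ->
    \forall x \ae mu, ~ N (tnth x j).
  move=> mN N0; exists [set x | N (tnth x j)]; split.
  - by rewrite -[X in measurable X]setTI; exact: measurable_tnth.
  - exact: torus_measure_coord.
  - by move=> x /= /contrapT.
have mC : measurable (~` `[0, 2 * pi]%classic : set R) by exact: measurableC.
have hC := ae_notin _ mC circle_measure_setC.
have h1 b := ae_notin [set b] (measurable_set1 b) (circle_measure_set1 b).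
have F : Filter (almost_everywhere mu) := ae_filter_ringOfSetsType mu.
apply: (filterS2 _ _ (filterI hC (h1 a)) (filterI (h1 0) (h1 (2 * pi)))).
move=> x /= [/contrapT + /eqP xa] [/eqP x0' /eqP x2'].
rewrite /= in_itv /= => /andP[x0 x2].
by rewrite !lt_neqAle eq_sym x0' x0 x2' x2.
Qed.

Lemma trig_set_ray (j : 'I_d) (a : R) : trig_set [set x | tnth x j < a].
Proof.
set E := [set x | _].
have mE : measurable E.
  rewrite -[E]setTI (_ : E = (tnth (T:=R))^~ j @^-1` `]-oo, a[%classic).
    exact: measurable_tnth.
  by apply/seteqP; split=> x; rewrite /E /= in_itv.
(* The threshold is clamped to one period, as [arc_poly_lt] requires; the half-space changes only by
   a null set. *)
split=> //; pose b := Num.min (Num.max a 0) (2 * pi).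
have p2 : 0 < 2 * pi :> R := pi2_gt0.
have b0 : 0 <= b <= 2 * pi.
  by rewrite ge_min lexx orbT andbT le_min le_max lexx orbT /= ltW.
have step_itv n x := step_poly_itv n (arc_poly_itv b (tnth x j)).
apply: (@trig_approx_dominated _ _ _
  (fun n x => (step_poly n (arc_poly b (tnth x j)))%:C) (cst 1%E)).
- by apply: cmeasurable_real; exact: measurable_indic.
- by move=> n; apply: trig_approx_trig; exact: trig_step_poly.
- exact: finite_measure_integrable_cst.
- move=> n x; rewrite -rmorphB normc_real lee_fin /=.
  have /andP[s0 s1] := step_itv n x.
  rewrite -real_normK ?num_real// -[leRHS](expr1n _ 2) lerXn2r ?nnegrE//.
  by rewrite indicE ler_norml; case: (x \in E) => /=; apply/andP; split; lra.
- have F : Filter (almost_everywhere mu) := ae_filter_ringOfSetsType mu.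
  have := torus_ae_coord j b; apply: filterS => x [x02 xb].
  have [pne plt] := arc_poly_lt x02 b0 xb.
  have xE : \1_E x = (arc_poly b (tnth x j) < 1 / 2)%R%:R :> R.
    rewrite plt indicE; congr (_%:R); congr nat_of_bool.
    apply/idP/idP; rewrite inE /E /=; have /andP[x0 x2] := x02.
      by move=> xa; rewrite /b lt_min x2 andbT lt_max xa.
    rewrite /b lt_min lt_max => /andP[/orP[//|x_lt0] _].
    by have := lt_trans x_lt0 x0; rewrite ltxx.
  under eq_fun do rewrite -rmorphB normc_real xE.
  set c : R := _%:R.
  have h : (c - step_poly n (arc_poly b (tnth x j))) @[n --> \oo] --> (c - c : R).
    by apply: cvgB; [exact: cvg_cst|exact: step_poly_cvg (arc_poly_itv _ _) pne].
  have := cvg_comp _ _ h (@exprn_continuous R 2 _).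
  by rewrite subrr expr0n.
Qed.

Lemma trig_set0 : trig_set set0.
Proof.
split=> //; rewrite (_ : (fun x => _) = fun=> 0).
  exact: trig_approx_trig Trig0.
by apply/funext => x; rewrite indic0.
Qed.

Lemma trig_setC (E : set T) : trig_set E -> trig_set (~` E).
Proof.
move=> [mE aE]; split; first exact: measurableC.
have := trig_approxD (trig_approx_trig (trig_poly_cst 1)) (trig_approxZ (-1) aE).
congr trig_approx; apply/funext => x.
rewrite !indicE in_setC; case: (x \in E) => /=.
  by rewrite mulr1 subrr.
by rewrite mulr0 addr0.
Qed.

Lemma trig_setI (E F : set T) : trig_set E -> trig_set F -> trig_set (E `&` F).
Proof.
move=> [mE aE] [mF aF]; split; first exact: measurableI.
have := trig_approxM (M := 1) aE aF.
rewrite (_ : (fun x => _ * _) = (fun x => (\1_(E `&` F) x)%:C)).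
  apply => x; rewrite normc_real indicE.
  by case: (x \in E); rewrite ?expr1n ?expr0n.
by apply/funext => x; rewrite indicI -rmorphM.
Qed.

(** Finite unions come from complements and intersections; at each point the indicators of the
    partial unions are eventually constant. *)
Lemma trig_set_bigcup (F : (set T)^nat) : (forall n, trig_set (F n)) ->
  trig_set (\bigcup_n F n).
Proof.
move=> tF.
have tU n : trig_set (\big[setU/set0]_(i < n) F i).
  elim: n => [|n IH].
    by rewrite big_ord0; exact: trig_set0.
  rewrite big_ord_recr /= -[X in trig_set X]setCK setCU.
  by apply/trig_setC/trig_setI; exact: trig_setC.
have mU : measurable (\bigcup_n F n).
  by apply: bigcupT_measurable => n; have [] := tF n.
split=> //; apply: (@trig_approx_dominated _ _ _
  (fun n x => (\1_(\big[setU/set0]_(i < n) F i) x)%:C) (cst 1%E)).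
- by apply: cmeasurable_real; exact: measurable_indic.
- by move=> n; have [] := tU n.
- exact: finite_measure_integrable_cst.
- move=> n x; rewrite -rmorphB normc_real lee_fin !indicE.
  case: (x \in _); case: (x \in _);
  by rewrite /= ?subrr ?subr0 ?sub0r ?sqrrN ?expr1n ?expr0n.
- apply: aeW => x; apply: cvg_near_cst.
  have [[m _ Fmx]|nF] := pselect ((\bigcup_n F n) x).
    exists m.+1 => // n mn; rewrite -rmorphB normc_real !indicE.
    rewrite !mem_set ?subrr ?expr0n//; last by exists m.
    by rewrite -bigcup_mkord; exists m.
  apply: nearW => n; rewrite -rmorphB normc_real !indicE.
  rewrite !memNset ?subrr ?expr0n//.
  by rewrite -bigcup_mkord => -[m _ Fm]; apply: nF; exists m.
Qed.

(** Generation in two stages: the product sigma-algebra by coordinate preimages of Borel sets, the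
    Borel sets of the line by open rays. *)
Lemma trig_set_measurable (E : set T) : measurable E -> trig_set E.
Proof.
have sa : sigma_algebra setT trig_set.
  split; [|by move=> A tA; rewrite setTD; exact: trig_setC|exact: trig_set_bigcup].
  exact: trig_set0.
apply: smallest_sub => // A; rewrite -bigcup_seq => -[j _] /= [B mB <-].
rewrite setTI.
have sb : sigma_algebra setT [set C : set R | trig_set ((tnth (T:=R))^~ j @^-1` C)].
  split=> /=.
  - by rewrite preimage_set0; case: sa.
  - by move=> C tC; rewrite setTD preimage_setC; exact: trig_setC.
  - by move=> F tF; rewrite preimage_bigcup; exact: trig_set_bigcup.
have : (@RGenInftyO.G R).-sigma.-measurable B.
  by rewrite -RGenInftyO.measurableE.
apply: (smallest_sub sb) => _ [a ->] /=.
by have := trig_set_ray j a; congr trig_set.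
Qed.

End trigonometric_completeness.

(** * From simple functions to all of L2 *)

Section trigonometric_L2.
Context {R : realType} {d : nat}.
Local Notation T := (torus R d).
Local Notation mu := (@torus_measure R d).
Local Notation normc := Normc.normc.
Local Open Scope complex_scope.
Implicit Types (f P : T -> R[i]).

Lemma trig_approx_sum n (F : 'I_n -> T -> R[i]) : (forall i, trig_approx (F i)) ->
  trig_approx (fun x => \sum_(i < n) F i x).
Proof.
elim: n F => [|n IH] F aF.
  by under eq_fun do rewrite big_ord0; exact: trig_approx_trig Trig0.
under eq_fun do rewrite big_ord_recr /=.
by apply: trig_approxD => //; apply: IH.
Qed.

Import HBNNSimple.

Lemma trig_approx_nnsfun (s : {nnsfun T >-> R}) : trig_approx (fun x => (s x)%:C).
Proof.
under eq_fun do rewrite fimfunEord rmorph_sum.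
apply: trig_approx_sum => i; under eq_fun do rewrite rmorphM.
apply: trig_approxZ; apply: (trig_set_measurable _).2.
exact: measurable_funPTI.
Qed.

(** Simple functions s increase to g, and (g - s)^2 <= g^2 is the integrable majorant. *)
Lemma trig_approx_ge0 (g : T -> R) : measurable_fun setT g -> (forall x, 0 <= g x) ->
  (\int[mu]_x (g x ^+ 2)%:E < +oo)%E -> trig_approx (fun x => (g x)%:C).
Proof.
move=> mg g0 ig; have mEg : measurable_fun setT (EFin \o g) by exact/measurable_EFinP.
have g0' x : setT x -> (0 <= (EFin \o g) x)%E by rewrite lee_fin.
pose s := nnsfun_approx measurableT mEg.
have sg n x : s n x <= g x.
  by rewrite -lee_fin /s nnsfun_approxE; exact: (le_approx _ g0').
have s0 n x : 0 <= s n x by exact: fun_ge0.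
apply: (@trig_approx_dominated _ _ _ (fun n x => (s n x)%:C)
  (EFin \o (fun x => g x ^+ 2))).
- exact: cmeasurable_real.
- by move=> n; exact: trig_approx_nnsfun.
- apply/integrableP; split.
    by apply/measurable_EFinP; exact: measurable_funX.
  by under eq_integral do rewrite /= ger0_norm ?sqr_ge0//.
- move=> n x; rewrite -rmorphB normc_real lee_fin lerXn2r ?nnegrE ?subr_ge0//.
  by rewrite lerBlDr lerDl.
- apply: aeW => x; under eq_fun do rewrite -rmorphB normc_real.
  have h : g x - s n x @[n --> \oo] --> (g x - g x : R).
    apply: cvgB; first exact: cvg_cst.
    by have /fine_cvgP[_] := cvg_nnsfun_approx measurableT mEg g0' (I : setT x).
  have := cvg_comp _ _ h (@exprn_continuous R 2 _).
  by rewrite subrr expr0n.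
Qed.

Lemma trig_approx_real (g : T -> R) : measurable_fun setT g ->
  (\int[mu]_x (g x ^+ 2)%:E < +oo)%E -> trig_approx (fun x => (g x)%:C).
Proof.
move=> mg ig.
have part (h : T -> R) : measurable_fun setT h -> (forall x, 0 <= h x <= `|g x|) ->
    trig_approx (fun x => (h x)%:C).
  move=> mh hg; apply: trig_approx_ge0 => // [x|]; first by have /andP[] := hg x.
  apply: le_lt_trans ig; apply: ge0_le_integral => //.
  - by move=> x _; rewrite lee_fin sqr_ge0.
  - by apply/measurable_EFinP; exact: measurable_funX.
  - by apply/measurable_EFinP; exact: measurable_funX.
  - move=> x _; have /andP[h0 h1] := hg x.
    by rewrite lee_fin -[leRHS]real_normK ?num_real// lerXn2r ?nnegrE.
have := trig_approxD (part _ (measurable_funrpos mg) _)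
  (trig_approxZ (-1) (part _ (measurable_funrneg mg) _)).
rewrite (_ : (fun x => _ + _) = fun x => (g x)%:C); last first.
  apply/funext => x; rewrite mulN1r -rmorphB; congr _%:C.
  by rewrite -[in RHS](funrposBneg g).
apply=> x.
- by rewrite funrpos_ge0 /= /funrpos ge_max ler_norm normr_ge0.
- by rewrite funrneg_ge0 /= /funrneg ge_max -normrN ler_norm normr_ge0.
Qed.

Lemma trig_approx_L2 f : f \in @sq_integrable R d -> trig_approx f.
Proof.
rewrite inE => -[[mr mi] If].
have part (h : T -> R) : measurable_fun setT h ->
    (forall x, h x ^+ 2 <= normc (f x) ^+ 2) -> trig_approx (fun x => (h x)%:C).
  move=> mh hf; apply: trig_approx_real => //.
  apply: le_lt_trans If; apply: ge0_le_integral => //.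
  - by move=> x _; rewrite lee_fin sqr_ge0.
  - by apply/measurable_EFinP; exact: measurable_funX.
  - by apply/measurable_EFinP; exact: cmeasurable_normc.
  - by move=> x _; rewrite lee_fin.
have ar : trig_approx (fun x => (complex.Re (f x))%:C).
  by apply: part => // x; rewrite sqr_normcE lerDl sqr_ge0.
have ai : trig_approx (fun x => (complex.Im (f x))%:C).
  by apply: part => // x; rewrite sqr_normcE lerDr sqr_ge0.
have := trig_approxD ar (trig_approxZ 'i ai).
congr trig_approx; apply/funext => x; case: (f x) => a b /=; simpc.
by [].
Qed.

Lemma trig_polyP P : trig_poly P -> exists (K : seq (d.-tuple int)) a,
  uniq K /\ P = fun x => \sum_(k <- K) a k * expk k x.
Proof.
elim=> [|b l {}P _ [K [a [uK ->]]]].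
  by exists [::], (fun=> 0); split=> //; apply/funext => x; rewrite big_nil.
have [lK|lK] := boolP (l \in K); last first.
  exists (l :: K), (fun k => if k == l then b else a k).
  rewrite /= lK uK; split=> //; apply/funext => x; rewrite big_cons eqxx.
  congr (_ + _); apply: eq_big_seq => k kK.
  by case: eqP => // kl; move: lK; rewrite -kl kK.
exists K, (fun k => a k + (if k == l then b else 0)); split=> //.
apply/funext => x; under [RHS]eq_bigr do rewrite mulrDl.
rewrite big_split addrC /=; congr (_ + _).
rewrite (bigD1_seq l)//= eqxx big1 ?addr0// => k /negPf ->.
by rewrite mul0r.
Qed.

End trigonometric_L2.
(** * Parseval's inequality *)

Section fourier_expansion.
Context {R : realType} {d : nat}.
Local Notation T := (torus R d).
Local Notation mu := (@torus_measure R d).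
Local Notation normc := Normc.normc.
Local Notation L2 := (L2 R d).
Local Open Scope complex_scope.
Local Open Scope quotient_scope.
Implicit Types (x y : L2) (k l : d.-tuple int).

Definition L2_sqnorm x : R := \int[mu]_t normc (val (repr x) t) ^+ 2.

Lemma sq_integrable_sqnorm (f : T -> R[i]) : f \in @sq_integrable R d ->
  mu.-integrable setT (EFin \o (fun t => normc (f t) ^+ 2)).
Proof.
rewrite inE => -[mf If]; apply/integrableP; split; first exact: measurable_sqint.
by under eq_integral do rewrite /= ger0_norm ?sqr_ge0//.
Qed.

Lemma L2_sqnorm_pi (f : L2fun R d) :
  L2_sqnorm (\pi_L2 f) = \int[mu]_t normc (val f t) ^+ 2.
Proof.
rewrite /L2_sqnorm; set g := repr _.
have : f == g %[mod L2] by rewrite reprK.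
rewrite -[_ == _]Quotient.idealrBE inE => fg0.
have fg : \forall t \ae mu, val g t = val f t.
  by apply: filterS fg0 => t; rewrite raddfB => /subr0_eq.
congr fine; apply: ae_eq_integral => //.
- exact: measurable_int (sq_integrable_sqnorm (valP g)).
- exact: measurable_int (sq_integrable_sqnorm (valP f)).
- by apply: filterS fg => t -> _.
Qed.

Lemma L2_sqnorm_ge0 x : 0 <= L2_sqnorm x.
Proof. by apply: Rintegral_ge0 => t _; exact: sqr_ge0. Qed.

Lemma L2_sqnorm_sqint (f : L2fun R d) : (L2_sqnorm (\pi_L2 f))%:E = sqint (val f).
Proof.
rewrite L2_sqnorm_pi /sqint fineK//.
exact: (integrable_fin_num measurableT (sq_integrable_sqnorm (valP f))).
Qed.

Definition expk_norm : R := (2 * pi) `^ (- (d%:R / 2)).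

Lemma expk_norm_sqr : expk_norm ^+ 2 * (2 * pi) ^+ d = 1.
Proof.
have p0 := @pi2_gt0 R.
rewrite /expk_norm expr2 -powRD; last by rewrite (gt_eqF p0) implybT.
rewrite -opprD -splitr powRN powR_mulrn ?ltW// mulVf//.
by rewrite expf_neq0// gt_eqF.
Qed.

Lemma sq_integrable_trig (P : T -> R[i]) : trig_poly P -> P \in @sq_integrable R d.
Proof.
move=> tP; rewrite inE; split; first exact: cmeasurable_trig.
have [M M0 PM] := trig_poly_bounded tP.
have PM' t : `|normc (P t) ^+ 2| <= M by rewrite ger0_norm ?sqr_ge0//; exact: PM.
have /integrableP[_] := @bounded_integrable R _ _ mu _ M
  (cmeasurable_normc (cmeasurable_trig tP)) PM'.
by under eq_integral do rewrite /= ger0_norm ?sqr_ge0//.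
Qed.

Lemma trig_poly_basis k : trig_poly (fun t : T => expk_norm%:C * expk k t).
Proof. exact/trig_polyZ/trig_poly_expk. Qed.

Definition basis_fun k : L2fun R d :=
  exist _ (fun t => expk_norm%:C * expk k t) (sq_integrable_trig (trig_poly_basis k)).

Definition basis k : L2 := \pi_L2 (basis_fun k).

Lemma expi_sub k l (t : T) : expk k t * expi (- phase l t) =
  expk [tuple tnth k j - tnth l j | j < d] t.
Proof.
rewrite /expk -expiD; congr expi; rewrite /phase -sumrB; apply: eq_bigr => j _.
by rewrite tnth_mktuple rmorphB mulrBl.
Qed.

Lemma cintegral_expk k : cintegral mu (expk k) =
  (if k == [tuple of nseq d 0] then (2 * pi) ^+ d else 0)%:C.
Proof.
by have [hc hs] := @integral_cos_sin_phase R d k; rewrite /cintegral /Rintegral hc hs.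
Qed.

Lemma coef_basis k l : coef (basis k) l = (k == l)%:R.
Proof.
rewrite coef_pi /fun_coef -/expk_norm.
have -> : cintegral mu (fun t => val (basis_fun k) t * expi (- phase l t)) =
    expk_norm%:C * cintegral mu (expk [tuple tnth k j - tnth l j | j < d]).
  set m := [tuple _ | _ < d].
  have mph := measurable_phase_pos (R := R) m.
  have ic := integrable_cos_comp mu mph; have is_ := integrable_sin_comp mu mph.
  have E t : val (basis_fun k) t * expi (- phase l t) = expk_norm%:C * expk m t.
    by rewrite -expi_sub mulrA.
  rewrite /cintegral; simpc; congr (_ +i* _).
    rewrite -RintegralZl//; apply: eq_Rintegral => t _.
    by rewrite E complexReM /= mul0r subr0.
  rewrite -RintegralZl//; apply: eq_Rintegral => t _.
  by rewrite E complexImM /= mul0r addr0.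
rewrite cintegral_expk mulrA -rmorphM -rmorphM.
have -> : ([tuple tnth k j - tnth l j | j < d] == [tuple of nseq d 0]) = (k == l).
  apply/eqP/eqP => [h|->].
    apply/eq_from_tnth => j; have := congr1 (fun u => tnth u j) h.
    by rewrite tnth_mktuple tnth_nseq => /subr0_eq.
  by apply/eq_from_tnth => j; rewrite tnth_mktuple tnth_nseq subrr.
case: (k == l); last by rewrite mulr0.
by rewrite -expr2 expk_norm_sqr.
Qed.

Lemma torus_measureT : mu setT = ((2 * pi) ^+ d)%:E.
Proof.
have [hc _] := @integral_cos_sin_phase R d [tuple of nseq d 0].
move: hc; rewrite eqxx => <-.
have -> : (fun x : T => (cos (phase [tuple of nseq d 0] x))%:E) = cst 1%E.
  apply/funext => x; rewrite (_ : phase _ x = 0) ?cos0//.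
  by rewrite /phase big1// => j _; rewrite tnth_nseq mul0r.
by rewrite integral_cst// mul1e.
Qed.

(** Expand the squared modulus pointwise, integrate so that the cross term becomes [coef], and
    complete the square. This stands in for an inner product: best approximation and the norms of
    finite sums follow from it. *)
Lemma L2_sqnormB_basis x a k :
  L2_sqnorm (x - a *: basis k) =
  L2_sqnorm x - normc (coef x k) ^+ 2 + normc (coef x k - a) ^+ 2.
Proof.
have -> : x - a *: basis k = \pi_L2 (repr x - a *: basis_fun k).
  rewrite -[in LHS](reprK x) -scaleNr -[in RHS]scaleNr addrC [in RHS]addrC.
  rewrite L2_piD; congr (_ + _); rewrite /basis.
  exact: L2_scale_pi.
rewrite L2_sqnorm_pi /coef /L2_sqnorm; move: (repr x) => f.
have sf := sq_integrable_sqnorm (valP f).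
have [ir ii] := integrable_modulated k (valP f).
set c := expk_norm.
pose Ir t := complex.Re (val f t * expi (- phase k t)).
pose Ii t := complex.Im (val f t * expi (- phase k t)).
have pt t : normc (val (f - a *: basis_fun k) t) ^+ 2 =
    normc (val f t) ^+ 2 + normc a ^+ 2 * c ^+ 2 -
    2 * c * (complex.Re a * Ir t + complex.Im a * Ii t).
  have -> : val (f - a *: basis_fun k) t = val f t - a * (c%:C * expk k t).
    by rewrite raddfB.
  rewrite /Ir /Ii /expk /expi cosN sinN.
  have := cos2Dsin2 (phase k t); rewrite !sqr_normcE.
  case: (val f t) => u v; case: a => p q /=; simpc => /=.
  move: (cos _) (sin _) => C S h.
  (* With cos^2 + sin^2 put back as a factor, both sides agree as polynomials. *)
  rewrite [in RHS](_ : c ^+ 2 = c ^+ 2 * (C ^+ 2 + S ^+ 2)); last by rewrite h mulr1.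
  by ring.
pose D t := complex.Re a * Ir t + complex.Im a * Ii t.
have iZ r (h : T -> R) : mu.-integrable setT (fun t => (h t)%:E) ->
    mu.-integrable setT (fun t => (r * h t)%:E).
  by move=> ih; under eq_fun do rewrite EFinM; exact: integrableZl.
have iS (h1 h2 : T -> R) : mu.-integrable setT (fun t => (h1 t)%:E) ->
    mu.-integrable setT (fun t => (h2 t)%:E) ->
    mu.-integrable setT (fun t => (h1 t + h2 t)%:E).
  by move=> i1 i2; under eq_fun do rewrite EFinD; exact: integrableD.
have iD : mu.-integrable setT (fun t => (D t)%:E).
  by apply: iS; exact: iZ.
have ic r : mu.-integrable setT (EFin \o (fun _ : T => r)).
  exact: finite_measure_integrable_cst.
under eq_Rintegral do rewrite pt.
rewrite RintegralB//; last 2 first.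
- by apply: iS => //; exact: ic.
- exact: iZ.
have mT : fine (mu setT) = (2 * pi) ^+ d by rewrite torus_measureT.
rewrite RintegralD//; set cc := \int[mu]_x (normc a ^+ 2 * c ^+ 2).
have -> : cc = normc a ^+ 2 * c ^+ 2 * (2 * pi) ^+ d.
  by rewrite /cc Rintegral_cst//; congr (_ * _); exact: mT.
rewrite RintegralZl// RintegralD//; [|exact: iZ|exact: iZ].
rewrite !RintegralZl//.
rewrite /fun_coef /cintegral -/expk_norm -/c.
set A := \int[mu]_x Ir x; set B := \int[mu]_x Ii x.
have E : normc a ^+ 2 * c ^+ 2 * (2 * pi) ^+ d = normc a ^+ 2.
  by rewrite -mulrA expk_norm_sqr mulr1.
rewrite E !sqr_normcE; case: (a) => p q /=; rewrite -/A -/B.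
by simpc => /=; ring.
Qed.

(** Subtract one term at a time: since the frequencies are distinct, the remaining coefficients do
    not change. *)
Lemma L2_sqnormB_sum x (K : seq (d.-tuple int)) a : uniq K ->
  L2_sqnorm (x - \sum_(k <- K) a k *: basis k) =
  L2_sqnorm x - \sum_(k <- K) normc (coef x k) ^+ 2
  + \sum_(k <- K) normc (coef x k - a k) ^+ 2.
Proof.
elim: K x => [|l K IH] x; first by rewrite !big_nil !subr0 addr0.
rewrite cons_uniq => /andP[lK uK]; rewrite !big_cons opprD addrA IH// L2_sqnormB_basis.
have E k : k \in K -> coef (x - a l *: basis l) k = coef x k.
  move=> kK; rewrite addrC -scaleNr coef_linear coef_basis.
  case: eqP => [lk|_]; last by rewrite mulr0 add0r.
  by move: lK; rewrite lk kK.
rewrite (eq_big_seq (fun k => normc (coef x k) ^+ 2)); last by move=> k /E ->.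
rewrite [X in _ + X = _](eq_big_seq (fun k => normc (coef x k - a k) ^+ 2)).
  by ring.
by move=> k /E ->.
Qed.

Lemma coefB x y k : coef (x - y) k = coef x k - coef y k.
Proof. by rewrite addrC -scaleN1r coef_linear mulN1r addrC. Qed.

Lemma coef_sum (K : seq (d.-tuple int)) a l : uniq K ->
  coef (\sum_(k <- K) a k *: basis k) l = (if l \in K then a l else 0).
Proof.
elim: K => [|k K IH]; first by rewrite big_nil Defs.coef0.
rewrite cons_uniq => /andP[kK uK].
rewrite big_cons coef_linear coef_basis IH// inE eq_sym.
case: eqP => [->|_]; last by rewrite mulr0 add0r.
by rewrite (negPf kK) mulr1 addr0.
Qed.

Lemma L2_pi0 : \pi_L2 (0 : L2fun R d) = 0.
Proof. by apply: (addrI (\pi_L2 0)); rewrite -L2_piD !addr0. Qed.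

Lemma L2_sqnorm_sum (K : seq (d.-tuple int)) a : uniq K ->
  L2_sqnorm (\sum_(k <- K) a k *: basis k) = \sum_(k <- K) normc (a k) ^+ 2.
Proof.
move=> uK; have z : L2_sqnorm 0 = 0.
  rewrite -L2_pi0 L2_sqnorm_pi; under eq_Rintegral do rewrite raddf0 Normc.normc0 expr0n.
  by rewrite Rintegral_cst// mul0r.
have := L2_sqnormB_sum 0 (fun k => - a k) uK.
under eq_bigr do rewrite scaleNr.
rewrite sumrN opprK add0r z => ->.
rewrite big1; last by move=> k _; rewrite Defs.coef0 Normc.normc0 expr0n.
by rewrite subr0 add0r; apply: eq_bigr => k _; rewrite Defs.coef0 sub0r opprK.
Qed.

Lemma L2_pi_sum (K : seq (d.-tuple int)) b :
  \pi_L2 (\sum_(k <- K) b k *: basis_fun k) = \sum_(k <- K) b k *: basis k.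
Proof.
elim: K => [|k K IH]; first by rewrite !big_nil L2_pi0.
by rewrite !big_cons L2_piD IH; congr (_ + _); rewrite -L2_scale_pi.
Qed.

Lemma L2_piB (f g : L2fun R d) : \pi_L2 (f - g) = \pi_L2 f - \pi_L2 g.
Proof. by apply/eqP; rewrite eq_sym subr_eq -L2_piD subrK. Qed.

(* By [L2_sqnormB_sum] the squared distance from x to any trigonometric polynomial
   with frequencies in K is at least |x|^2 - sum_K |coef x k|^2. *)
Lemma L2_sqnorm_approx x (e : R) : 0 < e -> exists2 K : seq (d.-tuple int),
  uniq K & L2_sqnorm x <= \sum_(k <- K) normc (coef x k) ^+ 2 + e.
Proof.
move=> e0; have [_ /(_ e e0)[P tP Pe]] := trig_approx_L2 (valP (repr x)).
have [K [a [uK PE]]] := trig_polyP tP.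
have c0 : expk_norm != 0.
  apply/eqP => c0; have := expk_norm_sqr.
  by rewrite c0 expr0n mul0r => /eqP; rewrite eq_sym oner_eq0.
have cC0 : expk_norm%:C != 0 :> R[i] by rewrite (inj_eq (@complexI R)) .
(* [basis] consists of normalised characters, P of plain ones. *)
pose b k := a k / expk_norm%:C.
have := L2_sqnormB_sum x b uK.
rewrite -L2_pi_sum -[in X in X - _](reprK x) -L2_piB; set y := \pi_L2 _ => sqB.
have Pe' : L2_sqnorm y <= e.
  rewrite -lee_fin L2_sqnorm_sqint; apply: le_trans Pe.
  rewrite le_eqVlt; apply/orP; left; apply/eqP.
  apply: eq_integral => t _; congr ((normc _ ^+ 2)%:E).
  rewrite raddfB raddf_sum PE !fctE fct_sumE; congr (_ - _).
  apply: eq_bigr => k _; rewrite -[LHS]/(b k * (expk_norm%:C * expk k t)).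
  by rewrite mulrA divfK.
exists K => //.
have : 0 <= \sum_(k <- K) normc (coef x k - b k) ^+ 2.
  by rewrite sumr_ge0// => k _; rewrite sqr_ge0.
by move: sqB Pe'; lra.
Qed.

(** This is the half of Parseval that rests on completeness: coefficients bound the norm. *)
Lemma L2_sqnorm_le_esum x :
  ((L2_sqnorm x)%:E <= \esum_(k in [set: d.-tuple int]) (normc (coef x k) ^+ 2)%:E)%E.
Proof.
apply/lee_addgt0Pr => e e0; have [K uK xK] := L2_sqnorm_approx x e0.
apply: (@le_trans _ _ (\sum_(k <- K) normc (coef x k) ^+ 2 + e)%:E).
  by rewrite lee_fin.
rewrite EFinD leeD2r// -sumEFin.
apply: esum_ge; exists [set` K]; first by split=> //; exact: finite_seq.
by rewrite fsbig_seq.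
Qed.

End fourier_expansion.
(** * Approximation numbers *)

Section approximation.
Context {R : realType} {d : nat}.
Variable s : R.
Hypothesis s0 : 0 < s.
Local Notation normc := Normc.normc.
Local Notation L2 := (L2 R d).
Local Notation X := (@Hmix R d s).
Local Notation w := (@mixed_weight R d s).
Local Notation embed := (@Hmix_embedding R d s).
Local Open Scope complex_scope.
Local Open Scope quotient_scope.
Implicit Types (x y : L2) (f g : X) (k l : d.-tuple int) (K : seq (d.-tuple int)).

Lemma mixed_weightE k : w k = (freq_size k)%:R `^ (2 * s).
Proof.
rewrite /mixed_weight /freq_size.
elim/big_rec2: _ => [|j a b _ ->]; first by rewrite powR1.
rewrite natrM powRM//; congr (_ `^ _ * _).
by rewrite -natr1 addrC natr_absz.
Qed.

Lemma mixed_weight_ge1 k : 1 <= w k.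
Proof.
rewrite mixed_weightE -[leLHS](powRr0 (freq_size k)%:R); apply: ler_powR.
  by rewrite ler1n freq_size_gt0.
by rewrite mulr_ge0// ltW.
Qed.

Lemma L2_normE x : L2_norm x = Num.sqrt (L2_sqnorm x).
Proof. by []. Qed.

Lemma mixed_sqnorm_ge0 x : (0 <= mixed_sqnorm s x)%E.
Proof.
by apply: esum_ge0 => k _; rewrite lee_fin mulr_ge0 ?sqr_ge0 ?mixed_weight_ge0.
Qed.

Lemma mixed_sqnorm_fin f : mixed_sqnorm s (val f) = (Hmix_norm f ^+ 2)%:E.
Proof.
have /in_HmixP fin := valP f.
rewrite /Hmix_norm sqr_sqrtr ?fine_ge0 ?mixed_sqnorm_ge0// fineK//.
by rewrite ge0_fin_numE// mixed_sqnorm_ge0.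
Qed.

Lemma le_esumZ (I : choiceType) (c : R) (a : I -> \bar R) : 0 <= c ->
  (forall i, 0 <= a i)%E ->
  (\esum_(i in [set: I]) (c%:E * a i) <= c%:E * \esum_(i in [set: I]) a i)%E.
Proof.
move=> c0 a0; apply: ge_ereal_sup => _ [F [finF FT] <-].
rewrite -ge0_mule_fsumr//; apply: lee_wpmul2l; first by rewrite lee_fin.
by apply: esum_ge; exists F.
Qed.

(** Parseval turns a coefficientwise comparison into a norm bound; the embedding, the partial sums
    and their remainders are all estimated this way. *)
Lemma L2_sqnorm_le_Hmix x f (c : R) : 0 <= c ->
  (forall k, normc (coef x k) ^+ 2 <= c * (normc (coef (val f) k) ^+ 2 * w k)) ->
  L2_sqnorm x <= c * Hmix_norm f ^+ 2.
Proof.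
move=> c0 xf; rewrite -lee_fin EFinM -mixed_sqnorm_fin.
apply: le_trans (L2_sqnorm_le_esum x) _.
apply: le_trans (le_esumZ c0 _); last first.
  by move=> k; rewrite lee_fin mulr_ge0 ?sqr_ge0 ?mixed_weight_ge0.
by apply: le_esum => k _; rewrite -EFinM lee_fin.
Qed.

Lemma L2_sqnorm_embed f : L2_sqnorm (val f) <= Hmix_norm f ^+ 2.
Proof.
rewrite -[leRHS]mul1r; apply: L2_sqnorm_le_Hmix => // k.
by rewrite mul1r ler_peMr ?sqr_ge0 ?mixed_weight_ge1.
Qed.

Lemma L2_sqnormB_le x y : L2_sqnorm (x - y) <= 2 * L2_sqnorm x + 2 * L2_sqnorm y.
Proof.
have mf (f : L2fun R d) : cmeasurable (val f) by have := valP f; rewrite inE => -[].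
rewrite -[x]reprK -[y]reprK -L2_piB -lee_fin EFinD !EFinM !L2_sqnorm_sqint.
move: (repr x) (repr y) => f g.
have -> : sqint (val g) = sqint (val (- g)).
  apply: eq_integral => t _; rewrite raddfN -[(- _) t]/(- (val g t)).
  by rewrite !sqr_normcE; case: (val g t) => a b /=; rewrite !sqrrN.
by have := sqintD (mf f) (mf (- g)); congr (_ <= _)%E.
Qed.

Lemma mixed_sqnorm_sum K a : uniq K ->
  mixed_sqnorm s (\sum_(k <- K) a k *: basis k) =
  (\sum_(k <- K) normc (a k) ^+ 2 * w k)%:E.
Proof.
move=> uK.
have -> : (\sum_(k <- K) normc (a k) ^+ 2 * w k)%:E =
    \esum_(k in [set` K]) (normc (a k) ^+ 2 * w k)%:E.
  rewrite esum_fset; last 2 first.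
  - exact: finite_seq.
  - by move=> k _; rewrite lee_fin mulr_ge0 ?sqr_ge0 ?mixed_weight_ge0.
  by rewrite -fsbig_seq// sumEFin.
rewrite /mixed_sqnorm.
rewrite [RHS]esum_mkcond; apply: eq_esum => k _.
rewrite coef_sum//; case: (boolP (k \in K)) => kK; first by rewrite mem_set.
by rewrite memNset ?Normc.normc0 ?expr0n ?mul0r//; exact/negP.
Qed.

Lemma in_Hmix_sum K a : uniq K -> \sum_(k <- K) a k *: basis k \in @in_Hmix R d s.
Proof. by move=> uK; apply/in_HmixP; rewrite mixed_sqnorm_sum// ltry. Qed.

Lemma in_Hmix_basis k : basis k \in @in_Hmix R d s.
Proof.
have := @in_Hmix_sum [:: k] (fun=> 1) isT.
by rewrite big_seq1 scale1r.
Qed.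

Definition Hbasis k : X := exist _ (basis k) (in_Hmix_basis k).

Definition partial_sum K f : L2 := \sum_(k <- K) coef (val f) k *: basis k.

Lemma partial_sum_linear K : linear (partial_sum K).
Proof.
move=> a f g; rewrite /partial_sum scaler_sumr -big_split; apply: eq_bigr => k _.
by rewrite linearP coef_linear scalerDl scalerA.
Qed.

HB.instance Definition _ K := GRing.isLinear.Build R[i] X L2 *:%R
  (partial_sum K) (partial_sum_linear K).

Lemma coef_lsum (I : finType) (c : I -> R[i]) (x : I -> L2) l :
  coef (\sum_i c i *: x i) l = \sum_i c i * coef (x i) l.
Proof.
apply: (big_rec2 (fun u v => coef u l = v)); first exact: Defs.coef0.
by move=> i v u _ <-; rewrite coef_linear.
Qed.

Lemma partial_sum_rank K : uniq K -> has_rank (partial_sum K : {linear X -> L2}) (size K).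
Proof.
move=> uK; have E (i : 'I_(size K)) :
    partial_sum K (Hbasis (tnth (in_tuple K) i)) = basis (tnth (in_tuple K) i).
  rewrite /partial_sum (bigD1_seq (tnth (in_tuple K) i)) ?mem_tnth//=.
  rewrite coef_basis eqxx scale1r big1 ?addr0// => k /negPf kK.
  by rewrite coef_basis eq_sym kK scale0r.
exists (fun i => Hbasis (tnth (in_tuple K) i)); split=> [c c0 i|f].
  have := congr1 (fun u => coef u (tnth (in_tuple K) i)) c0.
  rewrite (eq_bigr (fun j => c j *: basis (tnth (in_tuple K) j))); last first.
    by move=> j _; congr (_ *: _); exact: E.
  rewrite coef_lsum Defs.coef0 (bigD1 i)//= coef_basis eqxx mulr1 big1 ?addr0//.
  move=> j ji; rewrite coef_basis.
  by rewrite (inj_eq (elimT (tuple_uniqP (in_tuple K)) uK)) (negPf ji) mulr0.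
exists (fun i => coef (val f) (tnth (in_tuple K) i)).
rewrite (eq_bigr (fun j => coef (val f) (tnth (in_tuple K) j) *:
  basis (tnth (in_tuple K) j))); last by move=> j _; congr (_ *: _); exact: E.
by rewrite -(big_tnth _ _ K predT (fun k => coef (val f) k *: basis k)).
Qed.

Definition ball_image (A : {linear X -> L2}) : set R :=
  [set L2_norm (embed f - A f) | f in [set f : X | Hmix_norm f <= 1]].

Lemma Hmix_norm_ge0 f : 0 <= Hmix_norm f.
Proof. exact: sqrtr_ge0. Qed.

Lemma Hmix_norm0 : Hmix_norm (0 : X) = 0.
Proof.
rewrite /Hmix_norm raddf0 /mixed_sqnorm esum1 ?sqrtr0// => k _.
by rewrite Defs.coef0 Normc.normc0 expr0n mul0r.
Qed.

Lemma L2_norm_ge0 x : 0 <= L2_norm x.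
Proof. exact: sqrtr_ge0. Qed.

Lemma ball_image0 A : ball_image A !=set0.
Proof.
by exists (L2_norm (embed 0 - A 0)); exists 0 => //=; rewrite Hmix_norm0 ler01.
Qed.

Lemma op_norm_ge0 (A : {linear X -> L2}) :
  0 <= op_norm (@Hmix_norm R d s) (@L2_norm R d) (fun f => embed f - A f).
Proof.
have [hs|/sup_out] := pselect (has_sup (ball_image A)); last by rewrite /op_norm => ->.
have [r Ar] := ball_image0 A.
apply: le_trans (sup_upper_bound hs Ar).
by case: Ar => x _ <-; exact: L2_norm_ge0.
Qed.

(** By convention [sup] of an unbounded set is 0, so [op_norm] dominates the values on the unit ball
    only once this is known. *)
Lemma ball_image_ubound (A : {linear X -> L2}) :
  bounded_op (@Hmix_norm R d s) (@L2_norm R d) A -> has_ubound (ball_image A).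
Proof.
move=> [M AM]; exists (Num.sqrt (2 + 2 * M ^+ 2)) => _ [f /= f1 <-].
rewrite L2_normE ler_wsqrtr//; apply: le_trans (L2_sqnormB_le _ _) _.
have f2 : Hmix_norm f ^+ 2 <= 1 by rewrite exprn_ile1// Hmix_norm_ge0.
have := L2_sqnorm_embed f; have := AM f; rewrite L2_normE => h1 h2.
have h3 : L2_sqnorm (A f) <= M ^+ 2 * Hmix_norm f ^+ 2.
  rewrite -exprMn -[leLHS]sqr_sqrtr ?L2_sqnorm_ge0//.
  by rewrite lerXn2r ?nnegrE ?sqrtr_ge0// (le_trans _ h1)// sqrtr_ge0.
have h4 : M ^+ 2 * Hmix_norm f ^+ 2 <= M ^+ 2 by rewrite ler_piMr// sqr_ge0.
apply: (@le_trans _ _ (2 * Hmix_norm f ^+ 2 + 2 * (M ^+ 2 * Hmix_norm f ^+ 2))).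
  by apply: lerD; rewrite ler_pM2l.
by lra.
Qed.

Lemma partial_sum_bounded K : uniq K ->
  bounded_op (@Hmix_norm R d s) (@L2_norm R d) (partial_sum K).
Proof.
move=> uK; exists 1 => f; rewrite mul1r L2_normE -[leRHS]ger0_norm ?Hmix_norm_ge0//.
rewrite -sqrtr_sqr ler_wsqrtr// -[leRHS]mul1r; apply: L2_sqnorm_le_Hmix => // k.
rewrite coef_sum// mul1r; case: ifP => _.
  by rewrite ler_peMr ?sqr_ge0 ?mixed_weight_ge1.
by rewrite Normc.normc0 expr0n mulr_ge0 ?sqr_ge0 ?mixed_weight_ge0.
Qed.

(** The partial sum over the cross of level N - 1 has rank below n. Sizes are integers, so every
    frequency left in the remainder has size at least N, which gives the exact power. *)
Lemma approx_number_le n N : (0 < N)%N -> (size (hcross d N.-1) < n)%N ->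
  approx_number (@Hmix_norm R d s) (@L2_norm R d) embed n <= N%:R `^ (- s).
Proof.
move=> N0 Nn; have uK := hcross_uniq d N.-1; set K := hcross d N.-1 in Nn uK *.
set a := op_norm (@Hmix_norm R d s) (@L2_norm R d) (fun f => embed f - partial_sum K f).
apply: (@le_trans _ _ a).
  apply: ge_inf.
    by exists 0 => _ [A [_ _ ->]]; exact: op_norm_ge0.
  exists (partial_sum K); split=> //; first exact: partial_sum_bounded.
  by exists (size K) => //; exact: partial_sum_rank.
apply: ge_sup; first exact: (ball_image0 (partial_sum K)).
move=> _ [f /= f1 <-].
have NR : 0 < N%:R :> R by rewrite ltr0n.
rewrite L2_normE -[leRHS]ger0_norm ?powR_ge0// -sqrtr_sqr ler_wsqrtr//.
have f2 : Hmix_norm f ^+ 2 <= 1 by rewrite exprn_ile1// Hmix_norm_ge0.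
have c0 : 0 <= (N%:R `^ (- s)) ^+ 2 :> R by rewrite sqr_ge0.
apply: le_trans (_ : (N%:R `^ (- s)) ^+ 2 * Hmix_norm f ^+ 2 <= _); last first.
  by rewrite ler_piMr.
apply: L2_sqnorm_le_Hmix => // k.
rewrite coefB coef_sum//; case: ifPn => [_|].
  rewrite subrr Normc.normc0 expr0n mulr_ge0// mulr_ge0 ?sqr_ge0//.
  exact: mixed_weight_ge0.
rewrite mem_hcross -ltnNge prednK// subr0 => Nk.
rewrite mulrCA ler_peMr ?sqr_ge0// mixed_weightE.
rewrite -powR_mulrn ?powR_ge0// -powRrM mulNr powRN [s * _]mulrC ler_pdivlMl ?powR_gt0//.
by rewrite mulr1 ge0_ler_powR ?nnegrE ?ler0n ?ler_nat// mulr_ge0// ltW.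
Qed.

(** On the span of the characters in the cross of level N the mixed norm is at most N^s times the L2
    norm, and on a kernel vector of A the error is the full L2 norm. *)
Lemma approx_number_ge n N : (0 < n)%N -> (0 < N)%N -> (n <= size (hcross d N))%N ->
  N%:R `^ (- s) <= approx_number (@Hmix_norm R d s) (@L2_norm R d) embed n.
Proof.
move=> n0 N0 nN; apply: lb_le_inf.
  (* A lower bound passes to [inf] only for a nonempty set; the empty partial sum, of rank 0, is a
     competitor. *)
  exists (op_norm (@Hmix_norm R d s) (@L2_norm R d)
    (fun f => embed f - partial_sum [::] f)).
  exists (partial_sum [::]); split=> //; first exact: partial_sum_bounded.
  by exists 0%N => //; exact: (@partial_sum_rank [::]).
move=> _ [A [bA [m mn [e [_ Ae]]] ->]].
have uK := hcross_uniq d N; set K := hcross d N in nN uK *.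
have NR : 0 < N%:R :> R by rewrite ltr0n.
suff [f [f1 Af f2]] : exists f : X, [/\ Hmix_norm f <= 1, A f = 0 &
    L2_norm (val f) = N%:R `^ (- s)].
  rewrite -f2; apply: (ub_le_sup (ball_image_ubound bA)).
  by exists f => //; rewrite Af subr0.
pose kk i := tnth (in_tuple K) i.
(* Row i of the matrix holds coordinates of the image of the i-th character in the family [A (e j)],
   so a left kernel vector gives a combination killed by A. *)
have [C CE] := choice (fun i => Ae (Hbasis (kk i))).
pose M : 'M[R[i]]_(size K, m) := \matrix_(i, j) C i j.
(* More basis functions than the rank of A: some combination f is in its kernel. *)
have : kermx M != 0.
  rewrite -mxrank_eq0 mxrank_ker -lt0n subn_gt0.
  by rewrite (leq_ltn_trans (rank_leq_col _))// (leq_trans mn).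
move=> /rowV0Pn[v /sub_kermxP vM v0].
pose S := \sum_i normc (v 0 i) ^+ 2.
have S0 : 0 < S.
  have /rV0Pn[i vi] := v0; rewrite /S (bigD1 i)//=.
  rewrite ltr_pwDl ?sumr_ge0// => [|j _]; last exact: sqr_ge0.
  rewrite lt_neqAle sqr_ge0 andbT eq_sym sqrf_eq0.
  by apply: contra vi => /eqP/Normc.eq0_normc ->.
(* Scales f to L2 norm N^(-s); as the weights on K are at most N^(2s), its mixed norm is then at
   most 1. *)
pose t : R := N%:R `^ (- s) / Num.sqrt S.
(* The coefficients reindexed by frequency, to fit the formulas for sums over a duplicate-free list;
   for k in K exactly one index contributes. *)
pose a k : R[i] := \sum_(i | kk i == k) t%:C * v 0 i.
have kk_inj : injective kk := elimT (tuple_uniqP (in_tuple K)) uK.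
have aE i : a (kk i) = t%:C * v 0 i.
  by rewrite /a (big_pred1 i)// => j; rewrite (inj_eq kk_inj).
pose f : X := \sum_i (t%:C * v 0 i) *: Hbasis (kk i).
have fE : embed f = \sum_(k <- K) a k *: basis k.
  rewrite /f linear_sum [RHS]big_tnth; apply: eq_bigr => i _.
  by rewrite -/(kk i) aE linearZ.
rewrite -[embed f]/(val f) in fE.
have tS : \sum_(k <- K) normc (a k) ^+ 2 = (N%:R `^ (- s)) ^+ 2.
  rewrite big_tnth (eq_bigr (fun i => t ^+ 2 * normc (v 0 i) ^+ 2)) => [|i _].
    by rewrite -mulr_sumr -/S /t expr_div_n sqr_sqrtr ?ltW// divfK// gt_eqF.
  by rewrite -/(kk i) aE Normc.normcM exprMn normc_real.
exists f; split.
- rewrite -(@ler_pXn2r _ 2)// ?nnegrE ?Hmix_norm_ge0// expr1n -lee_fin.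
  rewrite -mixed_sqnorm_fin fE mixed_sqnorm_sum// lee_fin.
  apply: (@le_trans _ _ (\sum_(k <- K) normc (a k) ^+ 2 * N%:R `^ (2 * s))).
    rewrite big_seq [leRHS]big_seq; apply: ler_sum => k kK.
    rewrite ler_wpM2l ?sqr_ge0// mixed_weightE ge0_ler_powR ?nnegrE ?ler0n//.
      by rewrite mulr_ge0// ltW.
    by rewrite ler_nat -mem_hcross.
  rewrite -mulr_suml tS -powR_mulrn ?powR_ge0// -powRrM -powRD; last first.
    by rewrite (gt_eqF NR) implybT.
  by rewrite (_ : - s * 2 + 2 * s = 0) ?powRr0//; ring.
- rewrite linear_sum (eq_bigr (fun i => \sum_j (t%:C * (v 0 i * M i j)) *: A (e j))).
    rewrite exchange_big big1//= => j _; rewrite -scaler_suml -mulr_sumr.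
    by move/rowP/(_ j): vM; rewrite !mxE => ->; rewrite mulr0 scale0r.
  move=> i _; rewrite linearZ /= CE scaler_sumr; apply: eq_bigr => j _.
  by rewrite scalerA mxE mulrA.
- rewrite L2_normE fE L2_sqnorm_sum// tS sqrtr_sqr ger0_norm// powR_ge0.
Qed.

End approximation.

(** * Transfer of the counting asymptotics through the power function *)

Lemma continuous_powR (R : realType) (s c : R) : 0 < c ->
  {for c, continuous (fun x => x `^ s)}.
Proof.
move=> c0; apply: differentiable_continuous; apply/derivable1_diffP.
by apply: derivable_powR; rewrite in_itv/= c0.
Qed.

Theorem theorem4p3 (R : realType) (s : R) (d : nat) (hs : 0 < s)
    (hd : (0 < d)%N) :
  (fun n : nat =>
     n%:R `^ s *
     approx_number (@Hmix_norm R d s) (@L2_norm R d) (Hmix_embedding d s) n /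
     (ln n%:R) `^ (d.-1%:R * s)) @ \oo
  --> (2 ^+ d / (d.-1)`!%:R : R) `^ s.
Proof.
case: d hd => // d _; rewrite [d.+1.-1]/=.
have ex_m n : exists m, (n <= size (hcross d.+1 m))%N.
  by exists n; exact: size_hcross_ge.
(* The least level whose cross has at least n points; minimality yields the strict bound one level
   below. *)
pose m n := ex_minn (ex_m n).
have mP n : (0 < n)%N ->
    (size (hcross d.+1 (m n).-1) < n <= size (hcross d.+1 (m n)))%N.
  move=> n0; rewrite /m; case: ex_minnP => k nk kmin; rewrite nk andbT.
  rewrite ltnNge; apply/negP => /kmin; case: k nk {kmin} => [|k _ /=].
    by rewrite hcross_nil leqNgt n0.
  by rewrite ltnn.
have m_gt0 n : (0 < n)%N -> (0 < m n)%N.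
  by move=> n0; have /andP[_] := mP _ n0; case: (m n) => //; rewrite hcross_nil leqNgt n0.
have aE n : (0 < n)%N -> approx_number (@Hmix_norm R d.+1 s) (@L2_norm R d.+1)
    (Hmix_embedding d.+1 s) n = (m n)%:R `^ (- s).
  move=> n0; have /andP[n1 n2] := mP n n0; apply/le_anti/andP; split.
    by apply: approx_number_le => //; exact: m_gt0.
  by apply: approx_number_ge => //; exact: m_gt0.
have c0 : 0 < 2 ^+ d.+1 / d`!%:R :> R by rewrite divr_gt0 ?exprn_gt0// ltr0n fact_gt0.
(* The s-th power of n / (m (ln n)^d) is, for large n, the sequence of the theorem, since [aE] gives
   a_n = m^(-s). *)
have := cvg_comp _ _ (cvg_size_hcross_inv (R := R) mP) (continuous_powR (s := s) c0).
apply: cvg_trans; apply: near_eq_cvg; near=> n.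
have n1 : (1 < n)%N by near: n; exact: nbhs_infty_gt.
have n0 : (0 < n)%N by exact: ltnW.
have ln0 : 0 <= ln n%:R :> R by rewrite ln_ge0// ler1n.
have powVs x : 0 <= x -> x^-1 `^ s = (x `^ s)^-1.
  by move=> x0; rewrite -[x^-1]powR_inv1// -powRrM mulN1r powRN.
rewrite /= aE// powRM ?invr_ge0 ?mulr_ge0 ?exprn_ge0//.
rewrite powVs ?mulr_ge0 ?exprn_ge0// powRM ?exprn_ge0//.
by rewrite invfM mulrA powRN -powR_mulrn// -powRrM.
Unshelve. all: by end_near. Qed.
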